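(* Let $\mathcal{A}$ be a finite alphabet, $\mathcal{F}\subset\mathcal{A}^*$ a set of forbidden words, and $X=X(\mathcal{A},\mathcal{F})$ the induced subshift. Let $G'\subset\mathcal{L}(X)$ be the set of all words in $\mathcal{L}(X)$ which have no heavy$'$ subword as a prefix and no heavy$'$ subword as a suffix. Suppose \[ \sum_{n = 1}^{\infty} n^2 |\mathcal{F}_n| (3/|\mathcal{A}|)^{n/4} < \frac{1}{36}, \] and let $\mu$ be the unique measure of maximal entropy on $X$ (which exists and is unique under this hypothesis). Then there exist $\epsilon > 0$ and a syndetic set $S\subseteq\mathbb{N}$ so that $\mu(G'_n) > \epsilon$ for all $n \in S$, and there exist constants $D, D'>0$ so that for all $w \in G'$, \[ De^{-|w|h(X)} \leq \mu([w]) \leq D'e^{-|w|h(X)}. \]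
   Context: $\mathcal{A}^*$ is the set of finite (nonempty) words over $\mathcal{A}$, $|w|$ is the length of $w$, and $\mathcal{F}_n$ is the set of words in $\mathcal{F}$ of length $n$ ($\mathcal{F}$ may be infinite). $X(\mathcal{A},\mathcal{F})$ is the set of all $x\in\mathcal{A}^{\mathbb{Z}}$ that contain no word from $\mathcal{F}$ as a (contiguous) subword. $\sigma$ is the shift $(\sigma x)_n=x_{n+1}$. $\mathcal{L}(X)$ is the set of all finite words appearing in points of $X$, $\mathcal{L}_n(X)$ those of length $n$, and $h(X)=\lim_{n\to\infty}\frac1n\log|\mathcal{L}_n(X)|$ (natural logarithm). Subwords, prefixes and suffixes of a word are allowed to equal the whole word. A heavy$'$ subword is a (contiguous) subword of some $u\in\mathcal{F}$ whose length is at least $|u|/4$. $G'_n$ is the set of words in $G'$ of length $n$; $[w]=\{x\in X: x_1\ldots x_n=w\}$ for a word $w$ of length $n$; $\mu(G'_n):=\mu\left(\bigcup_{w\in G'_n}[w]\right)$. A measure of maximal entropy (MME) on $X$ is a $\sigma$-invariant Borel probability measure $\mu$ supported on $X$ with measure-theoretic entropy $h(\mu)=\lim_n -\frac1n\sum_{w\in\mathcal{A}^n}\mu([w])\log\mu([w])$ equal to $h(X)$. A set $S\subseteq\mathbb{N}$ is syndetic if there exists $N$ so that $\{k,\ldots,k+N-1\}\cap S\neq\varnothing$ for every $k$. *)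

(* Defs.v *)
From HB Require Import structures.
From mathcomp Require Import all_boot all_order all_algebra.
From mathcomp Require Import all_classical all_reals all_analysis.

Set Implicit Arguments.
Unset Strict Implicit.
Unset Printing Implicit Defensive.

Import Order.TTheory GRing.Theory Num.Theory.
Import numFieldNormedType.Exports.

Local Open Scope classical_set_scope.
Local Open Scope ring_scope.

(* Nonempty finite alphabets.  The library's measurable types are pointed, so
   a point of A^Z is needed to put a sigma-algebra on it; no definition below
   mentions the distinguished letter. *)
#[short(type="pointedFinType")]
HB.structure Definition PointedFinite := { A of Finite A & Pointed A }.

Definition fullshift (A : pointedFinType) : Type :=
  prod_topology (fun _ : int => discrete_topology A).

HB.instance Definition _ (A : pointedFinType) := Pointed.on (fullshift A).
HB.instance Definition _ (A : pointedFinType) := Nbhs.on (fullshift A).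
HB.instance Definition _ (A : pointedFinType) := Topological.on (fullshift A).

Notation borel_fullshift A := (g_sigma_algebraType (@open (fullshift A))).

Section Subshift.
Variable A : pointedFinType.
Variable F : set (seq A).

Implicit Types (x : fullshift A) (v w : seq A).

(* The word x_i x_(i+1) ... x_(i+n-1). *)
Definition window x (i : int) (n : nat) : seq A :=
  [seq (x (i + k%:Z) : A) | k <- iota 0 n].

Definition shift x : fullshift A := fun n : int => x (n + 1).

Definition subshift : set (fullshift A) :=
  [set x | forall (i : int) (u : seq A), F u -> window x i (size u) != u].

(* As elements of A^*, words of the language are nonempty. *)
Definition language : set (seq A) :=
  [set w | w != [::] /\
           exists x, subshift x /\ exists i : int, window x i (size w) = w].

Definition cylinder w : set (fullshift A) :=
  [set x | subshift x /\ window x 1 (size w) = w].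

Definition heavy' v : Prop :=
  exists u : seq A, [/\ F u, infix v u & (size u <= 4 * size v)%N].

Definition good' : set (seq A) :=
  [set w | [/\ language w,
               forall v, heavy' v -> ~~ prefix v w &
               forall v, heavy' v -> ~~ suffix v w]].

Definition good'_union (n : nat) : set (fullshift A) :=
  \bigcup_(w in [set w | good' w /\ size w = n]) cylinder w.

End Subshift.

Definition nwords (A : pointedFinType) (W : set (seq A)) (n : nat) : nat :=
  #|[set w : n.-tuple A | `[< W (tval w) >]]%SET|.

Section Entropy.
Variables (R : realType) (A : pointedFinType) (F : set (seq A)).

Definition top_entropy : R :=
  limn (fun n : nat => n%:R^-1 * ln (nwords (language F) n)%:R).

(* The convention 0 log 0 = 0 holds because ln 0 = 0. *)
Definition measure_entropy (mu : probability (borel_fullshift A) R) : R :=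
  limn (fun n : nat => - n%:R^-1 *
    \sum_(w : n.-tuple A)
      fine (mu (cylinder F w)) * ln (fine (mu (cylinder F w)))).

Definition shift_invariant (mu : probability (borel_fullshift A) R) : Prop :=
  forall B : set (borel_fullshift A), measurable B ->
    mu (@shift A @^-1` B) = mu B.

Definition is_MME (mu : probability (borel_fullshift A) R) : Prop :=
  [/\ shift_invariant mu,
      mu (subshift F) = 1%E &
      measure_entropy mu = top_entropy].

End Entropy.

Definition syndetic (S : set nat) : Prop :=
  exists N : nat, forall k : nat, exists j : nat, (k <= j < k + N)%N /\ S j.

(* Main.v *)
Require Import Defs.
From mathcomp Require Import all_boot all_order all_algebra.
From mathcomp Require Import all_classical all_reals all_analysis.
From mathcomp Require Import zify ring lra.

Import Order.TTheory GRing.Theory Num.Theory.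
Import numFieldNormedType.Exports.

Local Open Scope classical_set_scope.
Local Open Scope ring_scope.

Set Implicit Arguments.
Unset Strict Implicit.
Unset Printing Implicit Defensive.

(** Write [K] for the number of letters and [c = K / 3], and call a word
    admissible when it contains no forbidden word.

    Gluing.  A forbidden word that appears when two or three admissible words are
    juxtaposed has a half or a third of its length inside one of them, so one of
    the words then starts or ends with a heavy word ([adm_cat], [adm_cat3]).
    Two or three words with light ends can thus be juxtaposed.

    Light ends are the rule.  A heavy end can be cut to a subword of length
    [quarter n] of a forbidden word of length [n], and such subwords have total
    weight at most [1 / 36] when each word of length [l] is given the weight
    [c ^- l]; this is what the summability hypothesis says.  Hence for any
    distribution under which words of length [l] have mass [O(c ^- l)], a union
    bound makes heavy ends rare ([heavy_end_sum]).

    Counting.  The union bound is first applied to counts: the number [nadm n] of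
    admissible words grows by a factor of at least [c], almost all of these words
    have light ends, hence [nadm] is supermultiplicative up to a constant and
    [lam ^+ n <= nadm n <= C * lam ^+ n] with [C] close to 1 ([nadm_rate]).  By
    compactness the language of the subshift has the same growth rate, so that
    [ln lam] is the topological entropy ([top_entropyE]).

    Entropy.  Let [P w] be the mass of the cylinder of [w] under a measure of
    maximal entropy.  The entropy of [P] on words of length [n] is at least
    [n * ln lam] by subadditivity, within a constant of the largest value that
    [nadm] permits.  Any way to gain more than a constant is therefore impossible,
    and each of the two bounds below is derived from such a gain.

    Upper bound ([upper_gibbs]).  If [P w] exceeded [2 * C / lam ^+ size w], then
    among the aligned blocks of a long word the block [w] would be so frequent
    that prescribing its places would save entropy linearly in the length.

    With the upper bound, the union bound applies to [P] itself: a word of any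
    length has a heavy prefix or a heavy suffix with probability at most [1 / 6],
    and otherwise it is in [good'].  This is the first claim.

    Lower bound ([lower_gibbs]).  Suppose that [w] has light ends and that [P w] is
    far below [1 / lam ^+ size w].  A word of length [N] typically has at least
    [N / 2] places where [w] can be inserted, and few occurrences of [w].  Such
    words make up a fixed proportion of [lam ^+ N] because their probability is
    bounded below.  One insertion of [w] into them gives admissible words of length
    [N + size w], about [N / 2] for each word, and each result arises only as
    often as it contains [w], that is rarely.  For large [N] these are more than
    [C * lam ^+ (N + size w)] words. *)

(** * Sums over the words of a given length *)

Section WordSums.
Variables (R : realType) (A : finType).
Implicit Types (f g : seq A -> R) (v w : seq A) (m n : nat).

Definition wsum n f : R := \sum_(w : n.-tuple A) f w.

Lemma eq_wsum n f g : (forall w, size w = n -> f w = g w) -> wsum n f = wsum n g.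
Proof. by move=> fg; apply: eq_bigr => w _; rewrite fg ?size_tuple. Qed.

Lemma le_wsum n f g :
  (forall w, size w = n -> f w <= g w) -> wsum n f <= wsum n g.
Proof. by move=> fg; apply: ler_sum => w _; rewrite fg ?size_tuple. Qed.

Lemma wsum_ge0 n f : (forall w, size w = n -> 0 <= f w) -> 0 <= wsum n f.
Proof. by move=> f0; apply: sumr_ge0 => w _; rewrite f0 ?size_tuple. Qed.

Lemma wsumD n f g : wsum n (fun w => f w + g w) = wsum n f + wsum n g.
Proof. exact: big_split. Qed.

Lemma wsumZ n (a : R) f : wsum n (fun w => a * f w) = a * wsum n f.
Proof. by rewrite /wsum mulr_sumr. Qed.

Lemma wsumZr n (a : R) f : wsum n (fun w => f w * a) = wsum n f * a.
Proof. by rewrite /wsum mulr_suml. Qed.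

Lemma wsum_exchange (I : Type) (r : seq I) (P : pred I) n (F : I -> seq A -> R) :
  wsum n (fun w => \sum_(i <- r | P i) F i w) =
  \sum_(i <- r | P i) wsum n (F i).
Proof. exact: exchange_big. Qed.

Lemma wsum0 f : wsum 0 f = f [::].
Proof.
rewrite /wsum (bigD1 [tuple])//= big1 ?addr0// => w /eqP[].
exact: tuple0.
Qed.

Lemma wsumS n f : wsum n.+1 f = \sum_(a : A) wsum n (fun w => f (a :: w)).
Proof.
rewrite /wsum pair_big /=.
rewrite (reindex (fun p : A * n.-tuple A => cons_tuple p.1 p.2)) //=.
exists (fun t : n.+1.-tuple A => (thead t, behead_tuple t)) => t _ /=.
  by case: t => a w; congr (_, _); apply/val_inj.
by case/tupleP: t => a w; apply/val_inj.
Qed.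

Lemma wsum_cat m n f :
  wsum (m + n) f = wsum m (fun v => wsum n (fun w => f (v ++ w))).
Proof.
elim: m f => [|m IH] f; first by rewrite wsum0.
by rewrite addSn !wsumS; apply: eq_bigr => a _; rewrite IH.
Qed.

Lemma wsum1 f : wsum 1 f = \sum_(a : A) f [:: a].
Proof. by rewrite wsumS; apply: eq_bigr => a _; rewrite wsum0. Qed.

Lemma wsum_eq n v f :
  size v = n -> wsum n (fun w => (w == v)%:R * f w) = f v.
Proof.
move=> /eqP vn; rewrite /wsum (bigD1 (Tuple vn))//= eqxx mul1r.
by rewrite big1 ?addr0// => w /eqP wv; case: eqP => // e; rewrite ?mul0r//;
  case: wv; apply/val_inj.
Qed.

Lemma wsum_exchange2 m n (F : seq A -> seq A -> R) :
  wsum m (fun v => wsum n (F v)) = wsum n (fun w => wsum m (F^~ w)).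
Proof. exact: exchange_big. Qed.

Lemma wsum_prefix n v f :
  wsum (size v + n) (fun w => (prefix v w)%:R * f w) =
  wsum n (fun w => f (v ++ w)).
Proof.
rewrite wsum_cat -[RHS](wsum_eq (fun v' => wsum n (fun w => f (v' ++ w)))
  (erefl (size v))).
apply: eq_wsum => v' sv'; rewrite -wsumZ; apply: eq_wsum => w _.
by rewrite prefixE -sv' take_size_cat.
Qed.

Lemma wsum_suffix n v f :
  wsum (n + size v) (fun w => (suffix v w)%:R * f w) =
  wsum n (fun w => f (w ++ v)).
Proof.
rewrite wsum_cat; apply: eq_wsum => w sw.
rewrite -(wsum_eq (fun v' => f (w ++ v')) (erefl (size v))).
apply: eq_wsum => v' sv'.
by rewrite suffixE size_cat sv' addnK drop_size_cat // eq_sym.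
Qed.

Lemma wsum_const n (a : R) : wsum n (fun=> a) = a * #|A|%:R ^+ n.
Proof.
by rewrite /wsum sumr_const card_tuple -natrX mulr_natr.
Qed.

End WordSums.

(* The same word may be typed over the alphabet or over its underlying equality
   type; its two lengths are identified before calling [lia]. *)
Ltac size_lia := repeat match goal with |- context [@size ?T ?x] =>
  let n := fresh "n" in set n := (@size T x); move: n => n end; lia.

(** * Admissible words and heavy ends *)

Section Admissible.
Variables (A : pointedFinType) (F : set (seq A)).
Implicit Types (u v w s t : seq A) (E : rel (seq A)).

Definition adm w : bool := `[< forall u, F u -> ~~ infix u w >].

Definition heavy_end E w : bool := `[< exists v, heavy' F v /\ E v w >].

Notation hpre := (heavy_end (@prefix A)).
Notation hsuf := (heavy_end (@suffix A)).

Lemma admP w : reflect (forall u, F u -> ~~ infix u w) (adm w).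
Proof. exact: asboolP. Qed.

Lemma adm_infix v w : infix v w -> adm w -> adm v.
Proof.
move=> vw /admP aw; apply/admP => u Fu; apply: contra (aw u Fu) => uv.
exact: infix_trans vw.
Qed.

Lemma adm_catl v w : adm (v ++ w) -> adm v.
Proof. exact/adm_infix/prefixW/prefix_prefix. Qed.

Lemma adm_catr v w : adm (v ++ w) -> adm w.
Proof. exact/adm_infix/suffixW/suffix_suffix. Qed.

Lemma heavy_endPn E w : reflect (forall v, heavy' F v -> ~~ E v w)
                                (~~ heavy_end E w).
Proof.
apply: (iffP idP) => [/asboolPn h v hv|h].
  by apply/negP => Evw; apply: h; exists v.
by apply/asboolPn => -[v [hv Evw]]; move: (h v hv); rewrite Evw.
Qed.

Lemma cat_eq_split (s s' t t' : seq A) : s ++ t = s' ++ t' ->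
  (size s <= size s')%N -> exists r, s' = s ++ r /\ t = r ++ t'.
Proof.
move=> e le; exists (drop (size s) s'); split.
  rewrite -{1}(cat_take_drop (size s) s'); congr (_ ++ _).
  by rewrite -(takel_cat t' le) -e take_size_cat.
have := congr1 (drop (size s)) e.
rewrite drop_size_cat// drop_cat; case: ltnP => // le' ->.
have ee : size s = size s' by apply/eqP; rewrite eqn_leq le le'.
by rewrite ee subnn drop0 drop_size.
Qed.

Lemma infix_cat_split u s t : infix u (s ++ t) ->
  [\/ infix u s, infix u t |
      exists u1 u2, [/\ u = u1 ++ u2, suffix u1 s & prefix u2 t]].
Proof.
case/infixP => p [q e].
case: (leqP (size p) (size s)) => [ps|sp].
  have [s' [es e']] := cat_eq_split (esym e) ps.
  case: (leqP (size u) (size s')) => [us|su].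
    have [s'' [es' _]] := cat_eq_split e' us.
    by constructor 1; apply/infixP; exists p, s''; rewrite es es'.
  have [u2 [eu et]] := cat_eq_split (esym e') (ltnW su).
  by constructor 3; exists s', u2; split=> //; rewrite ?es ?et
    ?suffix_suffix ?prefix_prefix.
have [p' [ep et]] := cat_eq_split e (ltnW sp).
by constructor 2; apply/infixP; exists p', q.
Qed.

(** A forbidden word across the junction has at least half of its length on one
    side of it, and that half is a heavy end of one of the two words. *)
Lemma adm_cat v w : adm v -> adm w -> ~~ hsuf v -> ~~ hpre w -> adm (v ++ w).
Proof.
move=> av aw /heavy_endPn sv /heavy_endPn pw; apply/admP => u Fu.
apply/negP => /infix_cat_split[iv|iw|[u1 [u2 [eu su pu]]]].
- by move/admP: av => /(_ u Fu); rewrite iv.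
- by move/admP: aw => /(_ u Fu); rewrite iw.
have [l1|l2] := leqP (size u) (4 * size u1).
  have /sv : heavy' F u1 by exists u; split=> //; rewrite eu prefix_infix.
  by rewrite su.
have /pw : heavy' F u2.
  exists u; split=> //; first by rewrite eu suffix_infix.
  by move: l2; rewrite eu size_cat; size_lia.
by rewrite pu.
Qed.

(** A forbidden word that is not already excluded by [adm_cat] covers the middle
    word, so it is cut into three pieces, and the longest of them is heavy: it
    is a suffix of [v], a prefix of [t], or the middle word itself. *)
Lemma adm_cat3 v w t : adm v -> adm w -> adm t -> ~~ hsuf v -> ~~ hpre w ->
  ~~ hsuf w -> ~~ hpre t -> adm (v ++ w ++ t).
Proof.
move=> av aw at_ sv pw sw pt.
have avw := adm_cat av aw sv pw; have awt := adm_cat aw at_ sw pt.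
apply/admP => u Fu; apply/negP => /infix_cat_split[iv|iw|].
- by move/admP: av => /(_ u Fu); rewrite iv.
- by move/admP: awt => /(_ u Fu); rewrite iw.
case=> u1 [u2 [eu su /prefixP[q e]]].
case: (leqP (size u2) (size w)) => [l|/ltnW l].
  have [r [ew _]] := cat_eq_split (esym e) l.
  move/admP: avw => /(_ u Fu)/negP; apply.
  case/suffixP: su => p ev; apply/infixP; exists p, r.
  by rewrite ev eu ew !catA.
have [t1 [eu2 et]] := cat_eq_split e l.
have hv x : infix x u -> (size u <= 4 * size x)%N -> heavy' F x.
  by move=> xu lx; exists u.
have [l1|l1] := leqP (size u) (4 * size u1).
  move/heavy_endPn: sv => /(_ u1); rewrite su; case/(_ _)/negP => //.
  by apply: hv => //; rewrite eu prefix_infix.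
have [l2|l2] := leqP (size u) (4 * size t1).
  move/heavy_endPn: pt => /(_ t1); rewrite et prefix_prefix.
  case/(_ _)/negP => //.
  by apply: hv => //; rewrite eu eu2 catA suffix_infix.
move/heavy_endPn: pw => /(_ w); rewrite prefix_refl; case/(_ _)/negP => //.
apply: hv; first by rewrite eu eu2 infix_infix.
by move: l1 l2; rewrite eu eu2 !size_cat; size_lia.
Qed.

End Admissible.

Notation heavy_prefix F := (heavy_end F (@prefix _)).
Notation heavy_suffix F := (heavy_end F (@suffix _)).

(** * The union bound over heavy ends *)

Lemma ler_sum_term (R : numDomainType) (I : eqType) (r : seq I) (P : pred I)
    (f : I -> R) (i : I) : i \in r -> P i ->
  (forall j, P j -> 0 <= f j) -> f i <= \sum_(j <- r | P j) f j.
Proof.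
move=> ir Pi f0; rewrite (big_rem i ir) Pi lerDl sumr_ge0// => j /f0.
Qed.

Section UnionBound.
Variables (R : realType) (A : pointedFinType) (F : set (seq A)).
Hypothesis Fne : ~ F [::].
Implicit Types (u v w : seq A) (E : rel (seq A)).

(** The least length of a heavy word coming from a forbidden word of length [n],
    namely a quarter of [n] rounded up. *)
Definition quarter n : nat := (n + 3) %/ 4.

Lemma heavy_cut v : heavy' F v -> exists n, [/\ (0 < n)%N,
  (n <= 4 * size v)%N & exists2 u, F u /\ size u = n & infix v u].
Proof.
move=> [u [Fu vu le]]; exists (size u); split => //; last by exists u.
by case: u Fu {vu le} => // /Fne.
Qed.

Lemma infix_at v u : infix v u -> exists j, (j + size v <= size u)%N /\
  v = take (size v) (drop j u).
Proof.
case/infixP => p [q ->]; exists (size p); rewrite drop_size_cat//.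
by rewrite take_size_cat//; split=> //; rewrite !size_cat; size_lia.
Qed.

(** What prefix and suffix have in common, so that both ends of a word are
    treated at once. *)
Definition end_relation E := forall v w, E v w -> (size v <= size w)%N /\
  forall l, (l <= size v)%N -> exists v', [/\ size v' = l, infix v' v & E v' w].

Lemma end_prefix : end_relation (@prefix A).
Proof.
move=> v w vw; split=> [|l lv]; first exact: size_prefix.
exists (take l v); split; [exact: size_takel|exact: infix_take|].
exact: prefix_trans (prefix_take _ _) vw.
Qed.

Lemma end_suffix : end_relation (@suffix A).
Proof.
move=> v w vw; split=> [|l lv]; first by
  case/suffixP: vw => t ->; rewrite size_cat; size_lia.
exists (drop (size v - l) v); split.
- by move: lv; rewrite size_drop; size_lia.
- exact: infix_drop.
- exact: suffix_trans (suffix_drop _ _) vw.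
Qed.

Lemma heavy_end_le E m w : end_relation E -> size w = m ->
  (heavy_end F E w)%:R <= \sum_(1 <= n < (4 * m).+1)
     \sum_(u : n.-tuple A | `[< F u >]) \sum_(j < n | (j + quarter n <= n)%N)
       (E (take (quarter n) (drop j u)) w)%:R :> R.
Proof.
move=> EE sw; rewrite /heavy_end; case: asboolP => [|_]; last first.
  by rewrite sumr_ge0// => n _; rewrite sumr_ge0// => u _; rewrite sumr_ge0.
case=> v [/heavy_cut[n [n0 nv [u [Fu su] vu]]] Evw].
have [vw cut] := EE _ _ Evw.
have lq : (quarter n <= size v)%N by move: nv; rewrite /quarter; size_lia.
have [v' [sv' v'v Ev'w]] := cut _ lq.
have [j [ju ev']] := infix_at (infix_trans v'v vu).
rewrite sv' su in ju.
have q0 : (0 < quarter n)%N by rewrite /quarter; lia.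
have jn : (j < n)%N by lia.
have su' : size u == n by rewrite su.
pose S k : R := \sum_(u : k.-tuple A | `[< F u >])
  \sum_(j < k | (j + quarter k <= k)%N)
     (E (take (quarter k) (drop j u)) w)%:R.
apply: (@le_trans _ _ (S n)); last first.
  apply: (@ler_sum_term _ _ _ xpredT S) => //; first by rewrite mem_index_iota; lia.
  by move=> k _; rewrite sumr_ge0// => ? _; rewrite sumr_ge0.
apply: (le_trans _ (ler_sum_term (i := Tuple su') _ _ _)); rewrite ?mem_index_enum//.
- apply: (le_trans _ (ler_sum_term (i := Ordinal jn) _ _ _)); rewrite ?mem_index_enum//=.
  by rewrite -sv' -ev' Ev'w.
- exact/asboolP.
- by move=> ? _; rewrite sumr_ge0.
Qed.

(** A heavy end may be cut to a subword of length exactly [quarter n] of a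
    forbidden word of length [n], and there are at most [n] such subwords for each
    forbidden word.  The function [f] will be the indicator of admissible words in
    the counting part, and the mass of cylinders in the entropy part. *)
Lemma heavy_end_sum E (c B d : R) (f : seq A -> R) m : end_relation E ->
  0 <= B ->  0 < c -> (forall w, 0 <= f w) ->
  (forall N, \sum_(1 <= n < N) n%:R * (nwords F n)%:R * c ^- quarter n <= d) ->
  (forall v, (0 < size v <= m)%N ->
     wsum m (fun w => (E v w)%:R * f w) <= B * c ^- size v) ->
  wsum m (fun w => (heavy_end F E w)%:R * f w) <= B * d.
Proof.
move=> EE B0 c0 f0 wt Bv.
apply: le_trans (_ : \sum_(1 <= n < (4 * m).+1)
     \sum_(u : n.-tuple A | `[< F u >]) \sum_(j < n | (j + quarter n <= n)%N)
       wsum m (fun w => (E (take (quarter n) (drop j u)) w)%:R * f w) <= _).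
  rewrite [leRHS](_ : _ = wsum m (fun w => (\sum_(1 <= n < (4 * m).+1)
     \sum_(u : n.-tuple A | `[< F u >]) \sum_(j < n | (j + quarter n <= n)%N)
       (E (take (quarter n) (drop j u)) w)%:R) * f w)).
    by apply: le_wsum => w sw; rewrite ler_wpM2r// heavy_end_le.
  rewrite (eq_wsum (g := fun w => \sum_(1 <= n < (4 * m).+1)
     \sum_(u : n.-tuple A | `[< F u >]) \sum_(j < n | (j + quarter n <= n)%N)
       (E (take (quarter n) (drop j u)) w)%:R * f w)).
    rewrite wsum_exchange; apply: eq_bigr => n _.
    rewrite wsum_exchange; apply: eq_bigr => u _.
    by rewrite wsum_exchange.
  move=> w _; rewrite mulr_suml; apply: eq_bigr => n _.
  by rewrite mulr_suml; apply: eq_bigr => u _; rewrite mulr_suml.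
apply: le_trans (ler_wpM2l B0 (wt (4 * m).+1)); rewrite mulr_sumr.
rewrite big_nat_cond [leRHS]big_nat_cond.
apply: ler_sum => n /andP[/andP[n0 nm] _].
have q0 : (0 < quarter n)%N by rewrite /quarter; lia.
have c'0 k : 0 <= c ^- k by rewrite invr_ge0 exprn_ge0// ltW.
apply: le_trans (_ : \sum_(u : n.-tuple A | `[< F u >]) n%:R * (B * c ^- quarter n) <= _).
  apply: ler_sum => u _.
  apply: le_trans (_ : \sum_(j < n | (j + quarter n <= n)%N) B * c ^- quarter n <= _).
    apply: ler_sum => j jn.
    have st : size (take (quarter n) (drop j u)) = quarter n.
      by rewrite size_takel// size_drop size_tuple; lia.
    by rewrite -[in leRHS]st Bv// st /quarter; lia.
  rewrite sumr_const -[leLHS]mulr_natl ler_wpM2r ?mulr_ge0// ler_nat.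
  by rewrite -[leqRHS]card_ord max_card.
rewrite sumr_const -[leLHS]mulr_natl.
rewrite [leLHS](_ : _ = B * (n%:R * (nwords F n)%:R * c ^- quarter n))//.
rewrite /nwords cardsE /=; ring.
Qed.

End UnionBound.

(** * Counting admissible words *)

Section Counting.
Variables (R : realType) (A : pointedFinType) (F : set (seq A)).
Hypothesis Fne : ~ F [::].
Variable c : R.
Hypothesis c_gt0 : 0 < c.
Hypothesis cardA : #|A|%:R = 3 * c.
Hypothesis weight : forall N,
  \sum_(1 <= n < N) n%:R * (nwords F n)%:R * c ^- quarter n <= 36^-1.
Implicit Types (u v w : seq A) (m n : nat).

Definition nadm n : R := wsum n (fun w => (adm F w)%:R).

Lemma nadm_ge0 n : 0 <= nadm n.
Proof. exact: wsum_ge0. Qed.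

Lemma nadm0 : nadm 0 = 1.
Proof.
rewrite /nadm wsum0 (_ : adm F [::])//; apply/admP => u Fu.
by rewrite infixs0; apply/eqP => u0; apply: Fne; rewrite -u0.
Qed.

Lemma nadm_submul m n : nadm (m + n) <= nadm m * nadm n.
Proof.
rewrite /nadm wsum_cat -wsumZr; apply: le_wsum => v _.
rewrite -wsumZ; apply: le_wsum => w _.
rewrite -natrM ler_nat mulnb.
by case: (boolP (adm F (v ++ w))) => // a; rewrite (adm_catl a) (adm_catr a).
Qed.

Lemma adm_rcons w a : adm F w -> ~~ heavy_suffix F (w ++ [:: a]) ->
  adm F (w ++ [:: a]).
Proof.
move=> aw /heavy_endPn h; apply/admP => u Fu; apply/negP => iu.
have niw : ~~ infix u w by move/admP: aw; apply.
suff su : suffix u (w ++ [:: a]).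
  have hu : heavy' F u by exists u; split=> //; rewrite ?infix_refl//; lia.
  by move: (h u hu); rewrite su.
have [iw|ia|[u1 [u2 [eu su1 pu2]]]] := infix_cat_split iu.
- by rewrite iw in niw.
- move: ia; rewrite infixs1 => /orP[/eqP u0|/eqP ->]; first by case: Fne; rewrite -u0.
  exact: suffix_suffix.
- move: pu2; rewrite prefixs1 => /orP[/eqP u20|/eqP u2a]; last first.
    by case/suffixP: su1 eu => t ->; rewrite u2a => ->; rewrite -catA suffix_suffix.
  by move: niw; rewrite eu u20 cats0 (suffixW su1).
Qed.

Lemma nadm_shorten m l : (forall k, (k < m)%N -> c * nadm k <= nadm k.+1) ->
  (l <= m)%N -> nadm (m - l) <= nadm m * c ^- l.
Proof.
move=> H; elim: l => [|l IH] lm; first by rewrite subn0 expr0 invr1 mulr1.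
have cl : 0 < c ^+ l.+1 by rewrite exprn_gt0.
rewrite ler_pdivlMr// exprSr mulrA mulrAC -ler_pdivlMr ?exprn_gt0//.
apply: le_trans (IH (ltnW lm)); rewrite mulrC.
by rewrite -(subnSK lm); apply: H; lia.
Qed.

(** An admissible word of length [m] has [3 c] one-letter extensions, and the
    ones that are not admissible end in a heavy word.  By the union bound there
    are few of those, provided that the earlier counts grow at rate [c]. *)
Lemma nadm_grow m : c * nadm m <= nadm m.+1.
Proof.
have [k] := ubnP m; elim: k m => // k IH m mk.
have short l : (l <= m)%N -> nadm (m - l) <= nadm m * c ^- l.
  by apply: nadm_shorten => j jm; apply: IH; lia.
have cm0 : 0 <= c * nadm m by rewrite mulr_ge0 ?nadm_ge0// ltW.
have bad := @heavy_end_sum R A F Fne _ c (c * nadm m) 36^-1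
  (fun w => (adm F (take m w))%:R) m.+1 (@end_suffix A) cm0 c_gt0.
apply: le_trans (_ : wsum m.+1 (fun w => (adm F (take m w))%:R -
   (heavy_suffix F w)%:R * (adm F (take m w))%:R) <= _); last first.
  rewrite /nadm -addn1 !wsum_cat; apply: le_wsum => w sw.
  apply: le_wsum => -[//|a [|//]] _; rewrite take_size_cat//.
  have [aw|_] := boolP (adm F w); last by rewrite mulr0 subrr.
  have [_|h] := boolP (heavy_suffix F (w ++ [:: a])).
    by rewrite mulr1 subrr.
  by rewrite adm_rcons// mul0r subr0.
rewrite wsumD (_ : wsum _ _ = 3 * c * nadm m); last first.
  rewrite -addn1 wsum_cat /nadm -wsumZ; apply: eq_wsum => w sw.
  rewrite (eq_wsum (g := fun=> (adm F w)%:R)).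
    by rewrite wsum_const expr1 cardA mulrC.
  by move=> a _; rewrite take_size_cat.
rewrite (eq_wsum (g := fun w => -1 * ((heavy_suffix F w)%:R * (adm F (take m w))%:R))); last first.
  by move=> w _; rewrite mulN1r.
rewrite wsumZ mulN1r; move: bad => /(_ _ weight).
set X := wsum _ _ => bad.
suff : X <= c * nadm m * 36^-1.
  by move: cm0 => + XX; lra.
apply: bad => // v /andP[v0 vm].
rewrite -{1}(subnK vm) wsum_suffix.
have e : (m.+1 - size v = m - (size v).-1)%N by lia.
apply: le_trans (_ : nadm (m.+1 - size v) <= _).
  apply: le_wsum => w sw; rewrite ler_nat; case: (boolP (adm F (take _ _))) => //.
  rewrite take_cat sw; case: ltnP => [|_ /adm_catl ->//]; lia.
rewrite e; apply: le_trans (short _ _) _; first lia.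
rewrite -[in leRHS](prednK v0) exprS invfM mulrACA divff ?gt_eqF// mul1r.
by [].
Qed.

Lemma nadm_decay m l : (l <= m)%N -> nadm (m - l) <= nadm m * c ^- l.
Proof. by apply: nadm_shorten => k _; exact: nadm_grow. Qed.

Lemma nadm_gt0 n : 0 < nadm n.
Proof.
elim: n => [|n IH]; first by rewrite nadm0.
by apply: lt_le_trans (nadm_grow n); rewrite mulr_gt0.
Qed.

Lemma nadm_heavy_suffix m :
  wsum m (fun w => (heavy_suffix F w)%:R * (adm F w)%:R) <= nadm m * 36^-1.
Proof.
apply: (heavy_end_sum Fne (@end_suffix A) (nadm_ge0 m) c_gt0 _ weight) => // v.
move=> /andP[_ vm]; rewrite -{1}(subnK vm) wsum_suffix.
apply: le_trans (nadm_decay vm); apply: le_wsum => w _; rewrite ler_nat.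
by case: (boolP (adm F (w ++ v))) => // /adm_catl ->.
Qed.

Lemma nadm_heavy_prefix m :
  wsum m (fun w => (heavy_prefix F w)%:R * (adm F w)%:R) <= nadm m * 36^-1.
Proof.
apply: (heavy_end_sum Fne (@end_prefix A) (nadm_ge0 m) c_gt0 _ weight) => // v.
move=> /andP[_ vm]; rewrite -{1}(subnKC vm) wsum_prefix.
apply: le_trans (nadm_decay vm); apply: le_wsum => w _; rewrite ler_nat.
by case: (boolP (adm F (v ++ w))) => // /adm_catr ->.
Qed.

(** Words without a heavy suffix can be followed by words without a heavy
    prefix, and these make up all but one part in 36 of the words. *)
Lemma nadm_supmul m n : (35 / 36) ^+ 2 * (nadm m * nadm n) <= nadm (m + n).
Proof.
have light (E : rel (seq A)) k :
    wsum k (fun w => (heavy_end F E w)%:R * (adm F w)%:R) <= nadm k * 36^-1 ->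
    35 / 36 * nadm k <=
    wsum k (fun w => (~~ heavy_end F E w && adm F w)%:R).
  move=> H; have : wsum k (fun w => (~~ heavy_end F E w && adm F w)%:R) +
      wsum k (fun w => (heavy_end F E w)%:R * (adm F w)%:R) = nadm k.
    rewrite -wsumD; apply: eq_wsum => w _.
    by case: heavy_end; case: adm; rewrite /= ?mulr1 ?mulr0 ?add0r ?addr0.
  by move=> e; lra.
apply: le_trans (_ : wsum m (fun w => (~~ heavy_suffix F w && adm F w)%:R) *
   wsum n (fun w => (~~ heavy_prefix F w && adm F w)%:R) <= _).
  rewrite expr2 mulrACA ler_pM//.
  - by rewrite mulr_ge0 ?nadm_ge0//; lra.
  - by rewrite mulr_ge0 ?nadm_ge0//; lra.
  - exact/light/nadm_heavy_suffix.
  - exact/light/nadm_heavy_prefix.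
rewrite /nadm wsum_cat -wsumZr; apply: le_wsum => v _.
rewrite -wsumZ; apply: le_wsum => w _.
rewrite -natrM ler_nat mulnb.
have [/andP[sv av]|//] := boolP (~~ heavy_suffix F v && _).
have [/andP[pw aw]|//] := boolP (~~ heavy_prefix F w && _).
by rewrite (adm_cat av aw).
Qed.

Lemma nadm_supmul_iter m n : ((35 / 36) ^+ 2 * nadm n) ^+ m <= nadm (m * n).
Proof.
elim: m => [|m IH]; first by rewrite expr0 mul0n nadm0.
rewrite exprS mulSn; apply: le_trans (nadm_supmul _ _).
by rewrite -mulrA ler_wpM2l ?exprn_ge0 ?ler_wpM2l ?nadm_ge0//; lra.
Qed.

Lemma nadm_submul_iter m n : nadm (m * n) <= nadm m ^+ n.
Proof.
elim: n => [|n IH]; first by rewrite expr0 muln0 nadm0.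
rewrite exprS mulnS; apply: le_trans (nadm_submul _ _) _.
by rewrite ler_wpM2l ?nadm_ge0.
Qed.

(** The counts are exponential up to a bounded factor.  The rate is
    [inf_n ln (nadm n) / n]; the lower bound is its definition and the upper
    bound compares [nadm (m * n)] computed in the two ways above. *)
Lemma nadm_rate : exists h : R, [/\ c <= expR h,
  (forall n, expR h ^+ n <= nadm n) &
  (forall n, nadm n <= (36 / 35) ^+ 2 * expR h ^+ n)].
Proof.
pose E : set R := range (fun n : nat => ln (nadm n.+1) / n.+1%:R).
have lnpos n : nadm n \in Num.pos by rewrite posrE nadm_gt0.
have cexp n : c ^+ n <= nadm n.
  elim: n => [|n IH]; first by rewrite expr0 nadm0.
  rewrite exprS; apply: le_trans (nadm_grow n).
  by rewrite ler_wpM2l// ltW.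
have Elb : lbound E (ln c).
  move=> _ [n _ <-]; rewrite ler_pdivlMr ?ltr0n// mulr_natr -lnXn//.
  by rewrite ler_ln ?posrE ?exprn_gt0 ?nadm_gt0.
have E0 : E !=set0 by exists (ln (nadm 1) / 1%:R); exists 0%N.
have hE : has_inf E by split=> //; exists (ln c).
exists (inf E); split.
- rewrite -[leLHS]lnK ?posrE// ler_expR; exact: lb_le_inf.
- case=> [|n]; first by rewrite expr0 nadm0.
  rewrite -expRM_natl -[leRHS]lnK ?posrE ?nadm_gt0// ler_expR mulrC.
  rewrite -ler_pdivlMr ?ltr0n//; apply: ge_inf; first by exists (ln c).
  by exists n.
- case=> [|n]; first by rewrite expr0 mulr1 nadm0; lra.
  set t : R := (35 / 36) ^+ 2.
  have t0 : 0 < t by rewrite /t exprn_gt0//; lra.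
  have -> : (36 / 35) ^+ 2 = t^-1 :> R by rewrite /t -exprVn invf_div.
  rewrite mulrC ler_pdivlMr// mulrC.
  have tp m : t * nadm m \in Num.pos by rewrite posrE mulr_gt0// nadm_gt0.
  rewrite -expRM_natl -[leLHS]lnK// ler_expR [leRHS]mulrC -ler_pdivrMr ?ltr0n//.
  apply: lb_le_inf => // _ [m _ <-].
  rewrite ler_pdivrMr ?ltr0n// [leRHS]mulrAC ler_pdivlMr ?ltr0n//.
  rewrite !mulr_natr -!lnXn ?mulr_gt0 ?nadm_gt0//.
  rewrite ler_ln ?posrE ?exprn_gt0 ?mulr_gt0 ?nadm_gt0//.
  exact: le_trans (nadm_supmul_iter _ _) (nadm_submul_iter _ _).
Qed.

End Counting.

(** * Entropy of stationary word distributions *)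

Section Fekete.
Variable R : realType.
Implicit Types (u : nat -> R) (x y : R).

Lemma ln_exprn x n : 0 < x -> ln (x ^+ n) = n%:R * ln x.
Proof. by move=> x0; rewrite lnXn// mulr_natl. Qed.

Lemma natmul_bounded_le0 x y : (forall n : nat, n%:R * x <= y) -> x <= 0.
Proof.
move=> H; rewrite leNgt; apply/negP => x0.
have := H (Num.bound `|y / x|); rewrite -ler_pdivlMr// leNgt.
case/negP; apply: le_lt_trans (ler_norm _) _.
exact: archi_boundP.
Qed.

Lemma subadditive_mul u k r q : (forall m n, u (m + n)%N <= u m + u n) ->
  u (q * k + r)%N <= q%:R * u k + u r.
Proof.
move=> sub; elim: q => [|q IH]; first by rewrite mul0n add0n mul0r add0r.
rewrite mulSn -addnA; apply: le_trans (sub _ _) _.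
by rewrite -natr1 mulrDl mul1r; move: IH; lra.
Qed.

(** Fekete's lemma for nonnegative sequences. *)
Lemma fekete u : (forall m n, u (m + n)%N <= u m + u n) ->
  (forall n, 0 <= u n) ->
  exists l : R, [/\ (fun n => n%:R^-1 * u n) @ \oo --> l &
                forall n, n%:R * l <= u n].
Proof.
move=> sub u0.
pose E : set R := range (fun n : nat => u n.+1 / n.+1%:R).
have Elb : lbound E 0 by move=> _ [n _ <-]; rewrite divr_ge0.
have E0 : E !=set0 by exists (u 1%N / 1%:R); exists 0%N.
have hE : has_inf E by split=> //; exists 0.
have low n : n%:R * inf E <= u n.
  case: n => [|n]; first by rewrite mul0r.
  rewrite mulrC -ler_pdivlMr ?ltr0n//; apply: ge_inf; first by exists 0.
  by exists n.
exists (inf E); split=> //.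
apply/cvgrPdist_le => e e0.
have e2 : 0 < e / 2 by rewrite divr_gt0.
have [_ [k _ <-] ke] := inf_adherent e2 hE.
(* A common bound for the remainders [u (n %% k.+1)]. *)
pose M := \sum_(r < k.+1) u r.
exists (Num.bound (M / (e / 2))).+1 => // n /= Nn.
have n0 : 0 < n%:R :> R by rewrite ltr0n; lia.
have M0 : 0 <= M by rewrite sumr_ge0.
have ln : inf E <= n%:R^-1 * u n by rewrite mulrC ler_pdivlMr// mulrC.
rewrite ler_distlC; apply/andP; split; first by apply: le_trans ln; lra.
have kr : (n %% k.+1 < k.+1)%N by rewrite ltn_mod.
have ur : u (n %% k.+1)%N <= M.
  by rewrite /M (bigD1 (Ordinal kr))//= lerDl sumr_ge0.
have Me : n%:R^-1 * M <= e / 2.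
  rewrite mulrC ler_pdivrMr// mulrC -ler_pdivrMr//.
  apply: ltW; apply: lt_le_trans (archi_boundP (divr_ge0 M0 (ltW e2))) _.
  by rewrite ler_nat ltnW.
apply: le_trans (_ : u k.+1 / k.+1%:R + n%:R^-1 * M <= _); last first.
  by rewrite [in leRHS](splitr e) addrA lerD// ltW.
rewrite -(ler_pM2l n0) mulrDr !mulrA divff ?gt_eqF// !mul1r.
rewrite {1}(divn_eq n k.+1).
apply: le_trans (subadditive_mul _ _ _ sub) _; apply: lerD => //.
rewrite mulrAC ler_wpM2r// ler_pdivlMr ?ltr0n// -natrM ler_nat.
exact: leq_trunc_div.
Qed.

End Fekete.

(** The distribution of the words of a shift-invariant measure carried by the
    subshift: the only features of the measure that matter below. *)
Record word_distribution (R : realType) (A : pointedFinType)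
    (F : set (seq A)) (P : seq A -> R) : Prop := WordDistribution {
  wd_ge0 : forall w, 0 <= P w;
  wd_nil : P [::] = 1;
  wd_rcons : forall w, \sum_a P (w ++ [:: a]) = P w;
  wd_cons : forall w, \sum_a P (a :: w) = P w;
  wd_adm : forall w, ~~ adm F w -> P w = 0 }.

Section WordEntropy.
Variables (R : realType) (A : pointedFinType) (F : set (seq A)).
Variable P : seq A -> R.
Hypothesis PF : word_distribution F P.
Implicit Types (u v w y : seq A) (m n N : nat).

Let P0 : forall w, 0 <= P w := wd_ge0 PF.

Lemma wd_catr n w : wsum n (fun t => P (w ++ t)) = P w.
Proof.
elim: n w => [|n IH] w; first by rewrite wsum0 cats0.
rewrite wsumS -(wd_rcons PF); apply: eq_bigr => a _; rewrite -IH.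
by apply: eq_wsum => t _; rewrite -catA.
Qed.

Lemma wd_catl n w : wsum n (fun t => P (t ++ w)) = P w.
Proof.
elim: n w => [|n IH] w; first by rewrite wsum0.
rewrite -addn1 wsum_cat wsum_exchange2 wsum1 -(wd_cons PF).
apply: eq_bigr => a _; rewrite -IH.
by apply: eq_wsum => t _; rewrite -catA.
Qed.

Lemma wd_total n : wsum n P = 1.
Proof. by rewrite -(wd_nil PF) -(wd_catr n). Qed.

Lemma wd_factor N i n (g : seq A -> R) : (i + n <= N)%N ->
  wsum N (fun y => g (take n (drop i y)) * P y) = wsum n (fun v => g v * P v).
Proof.
move=> le; have -> : N = (i + (n + (N - (i + n))))%N by lia.
rewrite wsum_cat (eq_wsum (g := fun x => wsum n (fun v =>
  wsum (N - (i + n)) (fun r => g v * P (x ++ v ++ r))))); last first.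
  move=> x sx; rewrite wsum_cat; apply: eq_wsum => v sv; apply: eq_wsum => r _.
  by rewrite drop_size_cat// take_size_cat.
rewrite wsum_exchange2; apply: eq_wsum => v _.
rewrite wsum_exchange2 -(wd_catr (N - (i + n)) v) -wsumZ; apply: eq_wsum => r _.
by rewrite wsumZ wd_catl.
Qed.

Lemma wd_occ N i w : (i + size w <= N)%N ->
  wsum N (fun y => (prefix w (drop i y))%:R * P y) = P w.
Proof.
move=> le; under eq_wsum do rewrite prefixE.
rewrite (wd_factor (fun v => (v == w)%:R))// wsum_eq//.
Qed.

Lemma wd_take_le m w : P w <= P (take m w).
Proof.
rewrite -{1}(cat_take_drop m w) -(wd_catr (size (drop m w)) (take m w)).
rewrite -(wsum_eq (fun t => P (take m w ++ t)) (erefl (size (drop m w)))).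
by apply: le_wsum => t _; rewrite ler_piMl// lern1 leq_b1.
Qed.

Lemma wd_drop_le m w : P w <= P (drop m w).
Proof.
rewrite -{1}(cat_take_drop m w) -(wd_catl (size (take m w)) (drop m w)).
rewrite -(wsum_eq (fun t => P (t ++ drop m w)) (erefl (size (take m w)))).
by apply: le_wsum => t _; rewrite ler_piMl// lern1 leq_b1.
Qed.

Lemma wd_le1 w : P w <= 1.
Proof. by rewrite -(wd_nil PF) -(take0 w); exact: wd_take_le. Qed.

Definition word_entropy n : R := - wsum n (fun w => P w * ln (P w)).

Lemma word_entropy_ge0 n : 0 <= word_entropy n.
Proof.
rewrite /word_entropy -mulN1r -wsumZ; apply: wsum_ge0 => w _.
by rewrite mulN1r oppr_ge0 mulr_ge0_le0// ln_le0// wd_le1.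
Qed.

(** Gibbs' inequality.  Every weight [q] that is positive where [P] is bounds
    the entropy from above, so all the estimates on [P] below come from a choice of [q]. *)
Lemma gibbs_ineq n (q : seq A -> R) (S : R) : 0 < S ->
  (forall w, 0 <= q w) -> (forall w, size w = n -> 0 < P w -> 0 < q w) ->
  wsum n q <= S ->
  word_entropy n <= ln S - wsum n (fun w => P w * ln (q w)).
Proof.
move=> S0 q0 qP qS.
have key : wsum n (fun w => P w * ln (q w) - P w * ln (P w) - P w * ln S) <=
           wsum n (fun w => S^-1 * q w - P w).
  apply: le_wsum => w sw; have := P0 w; rewrite le_eqVlt => /orP[/eqP<-|Pw].
    by rewrite !mul0r !subr0 mulr_ge0// invr_ge0 ltW.
  have qw := qP w sw Pw.
  rewrite -!mulrBr -ln_div ?posrE// -ln_div ?posrE ?divr_gt0//.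
  have -> : S^-1 * q w - P w = P w * (q w / P w / S - 1).
    by field; rewrite !gt_eqF.
  rewrite ler_pM2l//; set x := q w / _ / _.
  have x0 : 0 < x by rewrite !divr_gt0.
  by have := @le_ln1Dx _ (x - 1); rewrite addrCA subrr addr0; apply; lra.
have split3 (f g h : seq A -> R) : wsum n (fun w => f w - g w - h w) =
    wsum n f - wsum n g - wsum n h.
  by rewrite /wsum !sumrB.
rewrite split3 in key.
have e : wsum n (fun w => P w * ln S) = ln S by rewrite wsumZr wd_total mul1r.
have f : wsum n (fun w => S^-1 * q w - P w) <= 0.
  rewrite /wsum sumrB subr_le0 -/(wsum n P) wd_total -mulr_sumr.
  by rewrite ler_pdivrMl// mulr1.
by rewrite /word_entropy; move: key; rewrite e; lra.
Qed.

Lemma word_entropy_subadd m n :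
  word_entropy (m + n) <= word_entropy m + word_entropy n.
Proof.
apply: le_trans (@gibbs_ineq (m + n) (fun w => P (take m w) * P (drop m w)) 1 _ _ _ _) _ => //.
- by move=> w; rewrite mulr_ge0.
- move=> w _ Pw; rewrite mulr_gt0//.
  + exact: lt_le_trans Pw (wd_take_le _ _).
  + exact: lt_le_trans Pw (wd_drop_le _ _).
- rewrite wsum_cat (eq_wsum (g := fun v => P v * wsum n P)).
    by rewrite wsumZr !wd_total mul1r.
  move=> v sv; rewrite -wsumZ; apply: eq_wsum => w _.
  by rewrite take_size_cat// drop_size_cat.
- rewrite ln1 sub0r (eq_wsum (g := fun w => ln (P (take m w)) * P w +
      ln (P (drop m w)) * P w)); last first.
    move=> w _; rewrite -mulrDl mulrC.
    have [Pw|] := ltP 0 (P w); last first.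
      by move=> h; rewrite (_ : P w = 0) ?mulr0//; apply/eqP; rewrite eq_le h P0.
    rewrite lnM ?posrE//.
    + exact: lt_le_trans Pw (wd_take_le _ _).
    + exact: lt_le_trans Pw (wd_drop_le _ _).
  have half k i : (i + k <= m + n)%N ->
      wsum (m + n) (fun w => ln (P (take k (drop i w))) * P w) =
      wsum k (fun w => P w * ln (P w)).
    move=> ik; rewrite (wd_factor (fun v => ln (P v)) ik).
    by apply: eq_wsum => w _; rewrite mulrC.
  rewrite wsumD /word_entropy opprD -(half m 0%N) ?leq_addr// -(half n m)//.
  apply: lerD; rewrite lerN2 le_eqVlt; apply/orP; left; apply/eqP.
    by apply: eq_wsum => w _; rewrite drop0.
  apply: eq_wsum => w sw; rewrite [take n _]take_oversize// size_drop sw.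
  by rewrite addKn.
Qed.

End WordEntropy.

(** * The upper Gibbs bound *)

Lemma drop_cat_le (T : Type) i (s t : seq T) : (i <= size s)%N ->
  drop i (s ++ t) = drop i s ++ t.
Proof.
rewrite leq_eqVlt drop_cat => /orP[/eqP->|->//].
by rewrite ltnn subnn drop0 drop_size.
Qed.

Section UpperGibbs.
Variables (R : realType) (A : pointedFinType) (F : set (seq A)).
Variables (P : seq A -> R) (C lam : R).
Hypothesis PF : word_distribution F P.
Hypothesis C_gt0 : 0 < C.
Hypothesis lam_gt0 : 0 < lam.
Hypothesis count : forall n, nadm R F n <= C * lam ^+ n.
Hypothesis entropy : forall n, n%:R * ln lam <= word_entropy P n.
Implicit Types (u v w y : seq A) (m n k N : nat).

(** Only aligned blocks are inspected: they do not overlap, so overlaps of [w]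
    with itself do not matter. *)
Definition block_weight w k y : R :=
  \prod_(i < k) (1 + (prefix w (drop (i * size w) y))%:R).

Lemma block_weight_cat w k y t : (k * size w <= size y)%N ->
  block_weight w k (y ++ t) = block_weight w k y.
Proof.
move=> ky; apply: eq_bigr => i _; congr (1 + _%:R).
have ik : (i * size w + size w <= size y)%N.
  by rewrite -mulSnr (leq_trans _ ky)// leq_mul2r ltn_ord orbT.
rewrite drop_cat_le ?(leq_trans (leq_addr _ _) ik)//.
by rewrite !prefixE takel_cat// size_drop leq_subRL ?(leq_trans (leq_addr _ _) ik).
Qed.

Lemma block_weight_gt0 w k y : 0 < block_weight w k y.
Proof. by apply: prodr_gt0 => i _; rewrite ltr_pwDl. Qed.

Lemma ln_block_weight w k y : ln (block_weight w k y) =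
  \sum_(i < k) (prefix w (drop (i * size w) y))%:R * ln 2.
Proof.
elim: k => [|k IH]; first by rewrite /block_weight !big_ord0 ln1.
rewrite /block_weight !big_ord_recr /= -/(block_weight w k y).
rewrite lnM ?posrE ?block_weight_gt0 ?ltr_pwDl// IH; congr (_ + _).
by case: prefix; rewrite ?mul1r ?mul0r ?addr0 ?ln1.
Qed.

Lemma block_weight_sum w k m :
  wsum (k * size w + m) (fun y => (adm F y)%:R * block_weight w k y) <=
  C * lam ^+ (k * size w + m) * (1 + C / lam ^+ size w) ^+ k.
Proof.
set n := size w; elim: k m => [|k IH] m.
  rewrite expr0 mulr1 mul0n add0n; apply: le_trans (count m).
  by apply: le_wsum => y _; rewrite /block_weight big_ord0 mulr1.
have e : (k.+1 * n + m = k * n + (n + m))%N by rewrite mulSn addnA (addnC n).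
have C0 := ltW C_gt0; have l0 := ltW lam_gt0.
set rho := 1 + _; have rho0 : 0 <= rho by rewrite addr_ge0// divr_ge0// exprn_ge0.
rewrite e (eq_wsum (g := fun y => (adm F y)%:R * block_weight w k y +
   (prefix w (drop (k * n) y))%:R * ((adm F y)%:R * block_weight w k y))); last first.
  by move=> y _; rewrite {1}/block_weight big_ord_recr /= -/(block_weight w k y); ring.
rewrite wsumD.
have second : wsum (k * n + (n + m)) (fun y => (prefix w (drop (k * n) y))%:R *
      ((adm F y)%:R * block_weight w k y)) <=
    (C * lam ^+ (k * n) * rho ^+ k) * (C * lam ^+ m).
  rewrite wsum_cat.
  apply: le_trans (_ : wsum (k * n) (fun y => (adm F y)%:R * block_weight w k y) *
    nadm R F m <= _); last first.
    have := IH 0%N; rewrite addn0 => IH0.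
    apply: ler_pM => //; last exact: nadm_ge0.
    by apply: wsum_ge0 => y _; rewrite mulr_ge0// ltW ?block_weight_gt0.
  rewrite -wsumZr; apply: le_wsum => y sy.
  under eq_wsum => t _ do rewrite drop_size_cat//.
  rewrite wsum_prefix -wsumZ; apply: le_wsum => t _.
  rewrite block_weight_cat ?sy// mulrAC ler_wpM2r ?(ltW (block_weight_gt0 _ _ _))//.
  rewrite -natrM ler_nat mulnb.
  by case: (boolP (adm F (y ++ _))) => // a; rewrite (adm_catl a) (adm_catr (adm_catr a)).
apply: le_trans (lerD (IH (n + m)%N) second) _.
rewrite le_eqVlt; apply/orP; left; apply/eqP.
have ln0 : lam ^+ n != 0 by rewrite expf_neq0// gt_eqF.
have er : rho * lam ^+ n = lam ^+ n + C by rewrite mulrDl mul1r divfK.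
rewrite [in RHS]exprS !exprD.
transitivity (C * lam ^+ (k * n) * lam ^+ m * rho ^+ k * (rho * lam ^+ n)).
  by rewrite er; ring.
by ring.
Qed.

(** A word [w] that is too frequent would cost entropy.  Doubling the weight of
    an admissible word for each aligned block equal to [w] raises the total weight
    by a factor [1 + C / lam ^+ size w] per block, and the mean logarithm of the
    weight by [P w * ln 2] per block; by Gibbs' inequality the second cannot
    exceed the logarithm of the first. *)
Lemma upper_gibbs w : (0 < size w)%N -> P w <= 2 * C / lam ^+ size w.
Proof.
move=> w0; set n := size w.
have C0 := ltW C_gt0; have l0 := ltW lam_gt0.
set rho := 1 + C / lam ^+ n.
have rho0 : 0 < rho by rewrite ltr_pwDl// divr_ge0// exprn_ge0.
have main k : k%:R * (P w * ln 2 - ln rho) <= ln C.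
  have S0 : 0 < C * lam ^+ (k * n) * rho ^+ k by rewrite !mulr_gt0// exprn_gt0.
  have Padm y : 0 < P y -> adm F y.
    by apply: contraLR => /(wd_adm PF) ->; rewrite ltxx.
  have := @gibbs_ineq R A F P PF (k * n)
    (fun y => (adm F y)%:R * block_weight w k y) _ S0.
  have q0 y : 0 <= (adm F y)%:R * block_weight w k y.
    by rewrite mulr_ge0// ltW ?block_weight_gt0.
  have qP y : size y = (k * n)%N -> 0 < P y -> 0 < (adm F y)%:R * block_weight w k y.
    by move=> _ /Padm ->; rewrite mul1r block_weight_gt0.
  have qS := block_weight_sum w k 0; rewrite addn0 in qS.
  move=> /(_ q0 qP qS) H; have := le_trans (entropy (k * n)) H.
  have -> : wsum (k * n) (fun y => P y * ln ((adm F y)%:R * block_weight w k y)) =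
      k%:R * (P w * ln 2).
    rewrite (eq_wsum (g := fun y => \sum_(i < k)
        (prefix w (drop (i * n) y))%:R * P y * ln 2)); last first.
      move=> y _; have [Py|] := ltP 0 (P y); last first.
        move=> Py; have -> : P y = 0 by apply/eqP; rewrite eq_le Py (wd_ge0 PF).
        by rewrite mul0r big1// => i _; rewrite mulr0 mul0r.
      rewrite Padm// mul1r ln_block_weight mulr_sumr; apply: eq_bigr => i _.
      by rewrite mulrCA mulrA.
    rewrite wsum_exchange (eq_bigr (fun=> P w * ln 2)).
      by rewrite sumr_const card_ord mulr_natl.
    move=> i _; rewrite wsumZr (wd_occ PF)// -mulSnr leq_mul2r ltn_ord orbT//.
  by rewrite !lnM ?posrE ?mulr_gt0 ?exprn_gt0// !ln_exprn//; lra.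
have : P w * ln 2 - ln rho <= 0 by apply: natmul_bounded_le0 main.
have : ln rho <= C / lam ^+ n.
  by apply: le_ln1Dx; rewrite (lt_le_trans (ltrN10 _))// divr_ge0// exprn_ge0.
have : 1 / 2 <= ln 2 :> R.
  have := @le_ln1Dx R (- (1 / 2)) _; rewrite (_ : 1 - 1 / 2 = 2^-1); last by lra.
  by rewrite lnV ?posrE//; lra.
have := wd_ge0 PF w; rewrite -/n -mulrA.
set x := C / _; nra.
Qed.

End UpperGibbs.

(** * The lower Gibbs bound *)

Section Occurrences.
Variable A : eqType.
Implicit Types (s t w : seq A).

Definition occ w s : nat := \sum_(0 <= i < size s) prefix w (drop i s).

Lemma occ_le_size w s : (occ w s <= size s)%N.
Proof.
rewrite /occ -[leqRHS]subn0 -[leqRHS]muln1 -sum_nat_const_nat.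
by apply: leq_sum => i _; exact: leq_b1.
Qed.

Lemma occ_cat_split w s t : occ w (s ++ t) =
  (\sum_(0 <= i < size s) prefix w (drop i s ++ t) + occ w t)%N.
Proof.
rewrite /occ size_cat (big_cat_nat (n := size s)) ?leq_addr//=; congr (_ + _)%N.
  by apply: eq_big_nat => i /andP[_ /ltnW i_s]; rewrite drop_cat_le.
rewrite -{1}[size s]add0n big_addn addKn; apply: eq_bigr => i _.
by rewrite drop_cat ltnNge leq_addl /= addnK.
Qed.

Lemma occ_cat_ge w s t : (occ w s + occ w t <= occ w (s ++ t))%N.
Proof.
rewrite occ_cat_split leq_add2r; apply: leq_sum => i _.
by case: (boolP (prefix w (drop i s))) => // h; rewrite prefix_catl.
Qed.

(** Only the last [size w] positions of [s] can see an occurrence of [w] that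
    is created by appending [t]. *)
Lemma occ_cat_le w s t : (occ w (s ++ t) <= occ w s + occ w t + size w)%N.
Proof.
rewrite occ_cat_split addnAC leq_add2r.
have short m : (\sum_(0 <= i < m) (m - i < size w) <= minn m (size w))%N.
  elim: m => [|m IH]; first by rewrite big_geq.
  rewrite big_nat_recl// subn0; under eq_bigr do rewrite subSS.
  by move: IH; case: ltnP; lia.
apply: leq_trans (leq_add (leqnn _) (leq_trans (short (size s)) (geq_minr _ _))).
rewrite /occ -big_split /=; apply: leq_sum => i _.
case: (boolP (prefix w (drop i s ++ t))) => // h.
case: ltnP => [|le]; first by rewrite addn1.
by rewrite addn0; move: h; rewrite !prefixE takel_cat ?size_drop// => ->.
Qed.

Lemma occ_insert w s t : (occ w (s ++ w ++ t) <= occ w (s ++ t) + 3 * size w)%N.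
Proof.
have h1 := occ_cat_le w s (w ++ t); have h2 := occ_cat_le w w t.
have h3 := occ_cat_ge w s t; have h4 := occ_le_size w w; lia.
Qed.

End Occurrences.

Section LowerGibbs.
Variables (R : realType) (A : pointedFinType) (F : set (seq A)).
Hypothesis Fne : ~ F [::].
Variables (P : seq A -> R) (c C lam : R).
Hypothesis c_gt0 : 0 < c.
Hypothesis weight : forall N,
  \sum_(1 <= n < N) n%:R * (nwords F n)%:R * c ^- quarter n <= 36^-1.
Hypothesis PF : word_distribution F P.
Hypothesis C_gt0 : 0 < C.
Hypothesis C_le : C <= 3 / 2.
Hypothesis c_le_lam : c <= lam.
Hypothesis count : forall n, nadm R F n <= C * lam ^+ n.
Hypothesis entropy : forall n, n%:R * ln lam <= word_entropy P n.
Implicit Types (u v w y : seq A) (m n k N : nat).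

Let P0 : forall w, 0 <= P w := wd_ge0 PF.
Let lam_gt0 : 0 < lam := lt_le_trans c_gt0 c_le_lam.

Lemma wd_upper_c v : (0 < size v)%N -> P v <= 2 * C * c ^- size v.
Proof.
move=> v0; apply: le_trans (upper_gibbs PF C_gt0 lam_gt0 count entropy v0) _.
have C2 : 0 <= 2 * C by rewrite mulr_ge0// ltW.
rewrite ler_wpM2l// lef_pV2 ?posrE ?exprn_gt0//.
by apply: lerXn2r; rewrite ?nnegrE// ltW.
Qed.

Lemma wd_heavy_suffix m :
  wsum m (fun w => (heavy_suffix F w)%:R * P w) <= 12^-1.
Proof.
have B0 : 0 <= 2 * C by rewrite mulr_ge0// ltW.
apply: le_trans (heavy_end_sum Fne (@end_suffix A) B0 c_gt0 P0 weight _) _.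
  move=> v /andP[v0 vm]; rewrite -(subnK vm) wsum_suffix (wd_catl PF).
  exact: wd_upper_c.
by move: C_le; lra.
Qed.

Lemma wd_heavy_prefix m :
  wsum m (fun w => (heavy_prefix F w)%:R * P w) <= 12^-1.
Proof.
have B0 : 0 <= 2 * C by rewrite mulr_ge0// ltW.
apply: le_trans (heavy_end_sum Fne (@end_prefix A) B0 c_gt0 P0 weight _) _.
  move=> v /andP[v0 vm]; rewrite -(subnKC vm) wsum_prefix (wd_catr PF).
  exact: wd_upper_c.
by move: C_le; lra.
Qed.

(** The condition of [adm_cat3] for inserting a word at position [i] of [y]. *)
Definition gap i y : bool :=
  ~~ heavy_suffix F (take i y) && ~~ heavy_prefix F (drop i y).

Definition gaps N y : R := \sum_(i < N) (gap i y)%:R.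

Lemma wd_nongap N i : (i < N)%N ->
  wsum N (fun y => (~~ gap i y)%:R * P y) <= 6^-1.
Proof.
move=> iN; apply: le_trans (_ : wsum N (fun y =>
    (heavy_suffix F (take i (drop 0 y)))%:R * P y +
    (heavy_prefix F (take (N - i) (drop i y)))%:R * P y) <= _).
  apply: le_wsum => y sy; rewrite drop0 (take_oversize (n := (N - i)%N)); last first.
    by rewrite size_drop sy.
  rewrite -mulrDl ler_wpM2r// -natrD ler_nat /gap.
  by do 2 case: heavy_end.
rewrite wsumD (wd_factor PF (fun v => (heavy_suffix F v)%:R)); last by rewrite add0n ltnW.
rewrite (wd_factor PF (fun v => (heavy_prefix F v)%:R)); last by rewrite subnKC// ltnW.
by have := wd_heavy_suffix i; have := wd_heavy_prefix (N - i); lra.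
Qed.

Section Insertion.
Variable w : seq A.
Hypotheses (w_adm : adm F w) (w_suf : ~~ heavy_suffix F w)
  (w_pre : ~~ heavy_prefix F w).
Hypothesis w_gt0 : (0 < size w)%N.
Variable p : R.
Hypotheses (p_gt0 : 0 < p) (Pw_le : P w <= p).

Definition sparse N y : bool :=
  [&& adm F y, N%:R / 2 <= gaps N y & (occ w y)%:R <= 3 * p * N%:R].

Lemma wd_mean_occ N : wsum N (fun y => (occ w y)%:R * P y) <= p * N%:R.
Proof.
rewrite (eq_wsum (g := fun y => \sum_(0 <= i < N) (prefix w (drop i y))%:R * P y)).
  rewrite wsum_exchange; apply: le_trans (_ : \sum_(0 <= i < N) p <= _).
    rewrite big_nat [leRHS]big_nat; apply: ler_sum => i _.
    have [le|gt] := leqP (i + size w) N.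
      by rewrite (wd_occ PF).
    apply: le_trans (_ : wsum N (fun=> 0) <= _).
      apply: le_wsum => y sy; case: (boolP (prefix w _)) => [/size_prefix|].
        by rewrite size_drop sy => h; exfalso; move: h gt w_gt0; size_lia.
      by rewrite mul0r.
    by rewrite wsum_const mul0r ltW.
  by rewrite big_const_nat subn0 iter_addr_0 mulr_natr.
by move=> y sy; rewrite /occ sy natr_sum mulr_suml.
Qed.

Lemma wd_sparse N : (0 < N)%N ->
  3^-1 <= wsum N (fun y => (sparse N y)%:R * P y).
Proof.
move=> N0; have n0 : 0 < N%:R :> R by rewrite ltr0n.
pose nongaps y : R := \sum_(i < N) (~~ gap i y)%:R.
have gn y : gaps N y + nongaps y = N%:R.
  rewrite -big_split /= (eq_bigr (fun=> 1)) ?sumr_const ?card_ord// => i _.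
  by case: gap; rewrite ?addr0 ?add0r.
have mean : wsum N (fun y => nongaps y * P y) <= N%:R / 6.
  rewrite (eq_wsum (g := fun y => \sum_(i < N) (~~ gap i y)%:R * P y)).
    rewrite wsum_exchange; apply: le_trans (_ : \sum_(i < N) 6^-1 <= _).
      by apply: ler_sum => i _; exact: wd_nongap.
    by rewrite sumr_const card_ord mulr_natl.
  by move=> y _; rewrite mulr_suml.
(* By Markov's inequality, applied to non-gaps with threshold [N / 2] and to
   occurrences with threshold [3 * p * N]: each fails with probability at most
   one third. *)
apply: le_trans (_ : wsum N (fun y => P y +
   (- (2 / N%:R)) * (nongaps y * P y) +
   (- (3 * p * N%:R)^-1) * ((occ w y)%:R * P y)) <= _); last first.
  apply: le_wsum => y _; have [Py|] := ltP 0 (P y); last first.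
    move=> h; have -> : P y = 0 by apply/eqP; rewrite eq_le h P0.
    by rewrite !mulr0 !addr0.
  rewrite [leLHS](_ : _ = (1 - 2 / N%:R * nongaps y -
    (3 * p * N%:R)^-1 * (occ w y)%:R) * P y); last by ring.
  rewrite ler_wpM2r// /sparse.
  have -> : adm F y by apply: contraLR Py => /(wd_adm PF) ->; rewrite ltxx.
  have a0 : 0 <= 2 / N%:R * nongaps y.
    by rewrite mulr_ge0 ?divr_ge0// sumr_ge0.
  have b0 : 0 <= (3 * p * N%:R)^-1 * (occ w y)%:R.
    by rewrite mulr_ge0// invr_ge0 !mulr_ge0// ltW.
  have [g|g] := leP (N%:R / 2) (gaps N y); last first.
    have : 1 <= 2 / N%:R * nongaps y.
      by rewrite mulrAC ler_pdivlMr// mul1r; have := gn y; lra.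
    by rewrite /=; lra.
  have [le_o|gt_o] := leP ((occ w y)%:R) (3 * p * N%:R); first by rewrite /=; lra.
  have : 1 <= (3 * p * N%:R)^-1 * (occ w y)%:R.
    by rewrite mulrC ler_pdivlMr ?mulr_gt0// mul1r ltW.
  by rewrite /=; lra.
rewrite !wsumD !wsumZ (wd_total PF) !mulNr.
have : 2 / N%:R * wsum N (fun y => nongaps y * P y) <= 3^-1.
  rewrite mulrAC ler_pdivrMr//; lra.
have : (3 * p * N%:R)^-1 * wsum N (fun y => (occ w y)%:R * P y) <= 3^-1.
  rewrite mulrC ler_pdivrMr ?mulr_gt0//; have := wd_mean_occ N; lra.
by lra.
Qed.

(** Since [P] nearly has maximal entropy on words of length [N], a set of words
    of probability at least one third cannot be small: otherwise giving its
    elements the weight [(4 * C) ^+ 3] in Gibbs' inequality would bound the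
    entropy by [N * ln lam + ln (2 * C) - ln (4 * C)]. *)
Lemma sparse_count N : (0 < N)%N ->
  C / (4 * C) ^+ 3 * lam ^+ N <= wsum N (fun y => (sparse N y)%:R).
Proof.
move=> N0; rewrite leNgt; apply/negP => small.
have [C1|C1] := ltP C 1.
  have := count 0; rewrite nadm0// expr0 mulr1; lra.
set x : R := (4 * C) ^+ 3 in small.
have x1 : 1 <= x by rewrite /x exprn_ege1//; move: C_gt0; lra.
have x0 : 0 < x by lra.
pose q y : R := if sparse N y then x else (adm F y)%:R.
have lN : 0 < lam ^+ N by rewrite exprn_gt0.
have S0 : 0 < 2 * C * lam ^+ N by rewrite !mulr_gt0.
have q0 y : 0 <= q y by rewrite /q; case: ifP => _ //; rewrite ltW.
have qP y : size y = N -> 0 < P y -> 0 < q y.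
  move=> _ Py; rewrite /q; case: ifP => // _; rewrite ltr0n lt0b.
  by apply: contraLR Py => /(wd_adm PF) ->; rewrite ltxx.
have qS : wsum N q <= 2 * C * lam ^+ N.
  apply: le_trans (_ : wsum N (fun y => x * (sparse N y)%:R + (adm F y)%:R) <= _).
    apply: le_wsum => y _; rewrite /q; case: sparse => /=.
      by rewrite mulr1 lerDl.
    by rewrite mulr0 add0r.
  rewrite wsumD wsumZ; have := count N; rewrite /nadm.
  have : x * wsum N (fun y => (sparse N y)%:R) <= C * lam ^+ N.
    rewrite -ler_pdivlMl//; apply: le_trans (ltW small) _.
    by rewrite le_eqVlt; apply/orP; left; apply/eqP; ring.
  by lra.
have H := le_trans (entropy N) (gibbs_ineq PF S0 q0 qP qS).
have eq : wsum N (fun y => P y * ln (q y)) =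
    wsum N (fun y => (sparse N y)%:R * P y) * ln x.
  rewrite -wsumZr; apply: eq_wsum => y _; rewrite /q.
  case: sparse; first by rewrite mul1r.
  rewrite (_ : ln (adm F y)%:R = 0) ?mulr0 ?mul0r//.
  by case: adm; [exact: ln1|exact: ln0].
have lx : 0 <= ln x by apply: ln_ge0.
have := ler_wpM2r lx (wd_sparse N0); rewrite -eq.
have -> : ln x = 3 * (ln 2 + ln (2 * C)).
  rewrite /x lnXn; last lra.
  by rewrite -lnM ?posrE ?mulr_gt0// [RHS]mulr_natl; congr (ln _ *+ _); ring.
move: H; rewrite lnM ?posrE ?mulr_gt0// ln_exprn//.
have : 0 < ln 2 :> R by apply: ln_gt0; lra.
by lra.
Qed.

(** Inserting [w] at a gap of a sparse word gives an admissible word that still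
    has few occurrences of [w], and the inserted copy is one of them: each image
    is thus obtained from few pairs of a word and a gap. *)
Lemma insertion_count N :
  wsum N (fun y => (sparse N y)%:R * gaps N y) <=
  (3 * p * N%:R + 3 * (size w)%:R) * nadm R F (N + size w).
Proof.
set T := _ + _.
pose G z : R := (adm F z && ((occ w z)%:R <= T))%:R.
have G0 z : 0 <= G z by [].
rewrite (eq_wsum (g := fun y => \sum_(i < N) (sparse N y)%:R * (gap i y)%:R)); last first.
  by move=> y _; rewrite mulr_sumr.
rewrite wsum_exchange.
apply: le_trans (_ : \sum_(i < N) wsum (N + size w) (fun z =>
    (prefix w (drop i z))%:R * G z) <= _).
  apply: ler_sum => -[i iN] _ /=.
  have -> : (N + size w = i + (size w + (N - i)))%N by lia.
  rewrite -[X in wsum X _ <= _](subnKC (ltnW iN)) !wsum_cat.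
  apply: le_wsum => a sa; under [leRHS]eq_wsum => t _ do rewrite drop_size_cat//.
  rewrite wsum_prefix; apply: le_wsum => b _.
  rewrite -natrM mulnb ler_nat.
  case: (boolP (_ && _)) => // /andP[/and3P[ab _ o]].
  rewrite /gap take_size_cat// drop_size_cat// => /andP[ha hb].
  rewrite adm_cat3 ?(adm_catl ab) ?(adm_catr ab)//=.
  rewrite lt0b; apply: le_trans (_ : (occ w (a ++ b) + 3 * size w)%:R <= _).
    by rewrite ler_nat occ_insert.
  by rewrite natrD natrM lerD2r.
rewrite -wsum_exchange /nadm -wsumZ; apply: le_wsum => z sz.
rewrite -mulr_suml /G; case: (boolP (adm F z)) => /= [_|]; last by rewrite !mulr0.
have [le_o|] := leP ((occ w z)%:R) T; rewrite ?mulr1 ?mulr0.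
  apply: le_trans le_o; rewrite /occ sz natr_sum.
  by rewrite (big_cat_nat (n := N)) ?leq_addr//= big_mkord lerDl sumr_ge0.
by rewrite /T addr_ge0 ?mulr_ge0// ltW.
Qed.

Lemma insertion_ineq N : (0 < N)%N ->
  C / (4 * C) ^+ 3 / 2 * N%:R <=
  (3 * p * N%:R + 3 * (size w)%:R) * (C * lam ^+ size w).
Proof.
move=> N0; have lN : 0 < lam ^+ N by rewrite exprn_gt0.
rewrite -(ler_pM2r lN).
apply: le_trans (_ : wsum N (fun y => (sparse N y)%:R * gaps N y) <= _).
  apply: le_trans (_ : wsum N (fun y => (sparse N y)%:R * (N%:R / 2)) <= _).
    rewrite wsumZr; have := ler_wpM2r _ (sparse_count N0).
    move=> /(_ (N%:R / 2)); rewrite divr_ge0// => /(_ isT); lra.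
  apply: le_wsum => y _; case: (boolP (sparse N y)) => [/and3P[_ g _]|].
    by rewrite !mul1r.
  by rewrite !mul0r.
apply: le_trans (insertion_count N) _.
have T0 : 0 <= 3 * p * N%:R + 3 * (size w)%:R by rewrite addr_ge0 ?mulr_ge0// ltW.
apply: le_trans (ler_wpM2l T0 (count _)) _.
by rewrite exprD; lra.
Qed.

End Insertion.

(** Dividing the insertion estimate by [N] and letting [N] go to infinity gives
    [p * lam ^+ size w >= 1 / (6 * (4 * C) ^+ 3)] for every positive upper bound
    [p] of [P w]; with 7 in place of 6 this fails. *)
Lemma lower_gibbs w : adm F w -> ~~ heavy_suffix F w -> ~~ heavy_prefix F w ->
  (0 < size w)%N -> (7 * (4 * C) ^+ 3)^-1 / lam ^+ size w <= P w.
Proof.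
move=> aw sw pw w0; rewrite leNgt; apply/negP => small.
set p := _ / _ in small.
have ln0 : 0 < lam ^+ size w by rewrite exprn_gt0.
have x0 : 0 < (4 * C) ^+ 3 by rewrite exprn_gt0 ?mulr_gt0.
have p0 : 0 < p by rewrite divr_gt0// invr_gt0 mulr_gt0.
have H := insertion_ineq aw sw pw w0 p0 (ltW small).
have : C / (4 * C) ^+ 3 * (1 / 14) <= 0.
  apply: (@natmul_bounded_le0 _ _ (3 * (size w)%:R * (C * lam ^+ size w))) => -[|N].
    by rewrite mul0r !mulr_ge0// ltW.
  have := H N.+1 isT.
  have -> : 3 * p * N.+1%:R = N.+1%:R * (3 / 7) / (4 * C) ^+ 3 / lam ^+ size w.
    by rewrite /p; field; rewrite !gt_eqF//=.
  rewrite [X in _ <= X]mulrDl.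
  have -> : N.+1%:R * (3 / 7) / (4 * C) ^+ 3 / lam ^+ size w * (C * lam ^+ size w) =
     N.+1%:R * (3 / 7) * (C / (4 * C) ^+ 3).
    by field; rewrite !gt_eqF//=.
  set y := C / _; set z := 3 * _ * _; lra.
by rewrite leNgt mulr_gt0 ?divr_gt0.
Qed.

End LowerGibbs.

(** * Windows, compactness and the language *)

Section Windows.
Variables (A : pointedFinType) (F : set (seq A)).
Implicit Types (x y : fullshift A) (u v w : seq A) (i : int) (n : nat).

Lemma size_window x i n : size (window x i n) = n.
Proof. by rewrite size_map size_iota. Qed.

Lemma windowS x i n : window x i n.+1 = (x i : A) :: window x (i + 1) n.
Proof.
rewrite /window /= addr0; congr (_ :: _).
rewrite (iotaDl 1 0) -map_comp; apply: eq_map => k /=.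
by rewrite -addrA -PoszD add1n.
Qed.

Lemma window_cat x i m n :
  window x i (m + n) = window x i m ++ window x (i + m%:Z) n.
Proof.
elim: m i => [|m IH] i; first by rewrite add0n addr0.
by rewrite addSn !windowS IH /= -addrA -(PoszD 1 m) add1n.
Qed.

Lemma window_shift x i n : window (Defs.shift x) i n = window x (i + 1) n.
Proof. by apply: eq_map => k; rewrite /Defs.shift addrAC. Qed.

Lemma nth_window a0 x i n k : (k < n)%N -> nth a0 (window x i n) k = x (i + k%:Z).
Proof. by move=> kn; rewrite (nth_map 0%N) ?size_iota// nth_iota. Qed.

Lemma infix_window u x i n : infix u (window x i n) ->
  exists j, window x j (size u) = u.
Proof.
case/infixP => s [t e]; exists (i + (size s)%:Z).
have en : n = (size s + (size u + size t))%N.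
  by rewrite -(size_window x i n) e !size_cat.
move: e; rewrite en !window_cat => /eqP.
by rewrite eqseq_cat ?size_window// => /andP[_]; rewrite eqseq_cat ?size_window//
  => /andP[/eqP].
Qed.

Lemma subshift_adm x i n : subshift F x -> adm F (window x i n).
Proof.
move=> xX; apply/admP => u Fu; apply/negP => /infix_window[j e].
by have := xX j u Fu; rewrite e eqxx.
Qed.

Lemma language_adm w : language F w -> adm F w.
Proof. by case=> _ [x [xX [i <-]]]; exact: subshift_adm. Qed.

Lemma subshift_shift x : subshift F (Defs.shift x) <-> subshift F x.
Proof.
split=> xX i u Fu; last by rewrite window_shift; exact: xX.
by have := xX (i - 1) u Fu; rewrite window_shift subrK.
Qed.

Lemma open_window i n w : open [set x : fullshift A | window x i n = w].
Proof.
elim: n i w => [|n IH] i [|a w].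
- by rewrite (_ : [set _ | _] = setT); [exact: openT|by apply/seteqP; split].
- by rewrite (_ : [set _ | _] = set0); [exact: open0|by apply/seteqP; split].
- by rewrite (_ : [set _ | _] = set0); [exact: open0|by apply/seteqP; split].
rewrite (_ : [set _ | _] = [set x : fullshift A | (x i : A) = a] `&`
    [set x | window x (i + 1) n = w]); last first.
  apply/seteqP; split=> x /=; rewrite windowS; first by case.
  by case=> -> ->.
apply: openI => //.
have coord : continuous (fun x : fullshift A => x i : discrete_topology A).
  exact: (@proj_continuous int (fun=> discrete_topology A) i).
exact: (iffLR (@continuousP (fullshift A) (discrete_topology A) (fun x => x i))
  coord [set a] (discrete_open _)).
Qed.

Lemma compact_fullshift : compact [set: fullshift A].
Proof.
have := @tychonoff int (fun=> discrete_topology A) (fun=> setT) _.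
rewrite (_ : [set f | _] = setT); last by apply/seteqP.
by apply=> i; apply: finite_compact; exact: (@finite_finset A).
Qed.

Definition extendable M w : bool := `[< exists l r : seq A,
  [/\ size l = M, size r = M & adm F (l ++ w ++ r)] >].

Lemma extendable_catl M v w : extendable M (v ++ w) -> extendable M v.
Proof.
case/asboolP => l [r [sl sr a]]; apply/asboolP; exists l, (take M (w ++ r)).
split=> //; first by rewrite size_takel// size_cat sr leq_addl.
apply: adm_infix a; apply: prefixW.
by apply/prefixP; exists (drop M (w ++ r)); rewrite -!catA cat_take_drop.
Qed.

Lemma extendable_catr M v w : extendable M (v ++ w) -> extendable M w.
Proof.
case/asboolP => l [r [sl sr a]]; apply/asboolP.
exists (drop (size v) (l ++ v)), r; split=> //.
  by rewrite size_drop size_cat addnK.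
apply: adm_infix a; apply: suffixW; apply/suffixP.
by exists (take (size v) (l ++ v)); rewrite !catA cat_take_drop.
Qed.

Lemma extendable_le M N w : (M <= N)%N -> extendable N w -> extendable M w.
Proof.
move=> MN /asboolP[l [r [sl sr a]]]; apply/asboolP.
exists (drop (N - M) l), (take M r); split.
- by rewrite size_drop sl subKn.
- by rewrite size_takel// sr.
apply: adm_infix a; apply/infixP; exists (take (N - M) l), (drop M r).
by rewrite -!catA cat_take_drop !catA cat_take_drop.
Qed.

Lemma window_nth a0 (s : seq A) (M p k : nat) i : i + M%:Z = p%:Z ->
  (p + k <= size s)%N ->
  window (fun j : int => nth a0 s `|(j + M%:Z)%R|%N : discrete_topology A) i k =
  take k (drop p s).
Proof.
move=> ip pk; apply: (@eq_from_nth _ a0).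
  by rewrite size_window size_takel// size_drop leq_subRL//; lia.
rewrite size_window => j jk; rewrite nth_window// nth_take// nth_drop.
by rewrite addrAC ip -PoszD absz_nat.
Qed.

(** By compactness, a word with arbitrarily long admissible extensions occurs
    in a point of the subshift: a cluster point of the extensions. *)
Lemma extendable_language w : w != [::] -> (forall M, extendable M w) ->
  language F w.
Proof.
move=> w0 ext; split=> //.
have /choice[f Hf] : forall M, exists lr : seq A * seq A,
    [/\ size lr.1 = M, size lr.2 = M & adm F (lr.1 ++ w ++ lr.2)].
  by move=> M; have /asboolP[l [r H]] := ext M; exists (l, r).
pose s M := (f M).1 ++ w ++ (f M).2.
pose xs M : fullshift A := fun j : int => nth point (s M) `|(j + M%:Z)%R|%N.
have [x [_ clx]] : [set: fullshift A] `&` cluster (xs @ \oo) !=set0.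
  by apply: compact_fullshift; exact: filterT.
have agree i n (M0 : nat) : exists M, (M0 <= M)%N /\
    window (xs M) i n = window x i n.
  have [||y [[M M0M <-] e]] := clx [set xs M | M in [set M | (M0 <= M)%N]]
      [set y | window y i n = window x i n].
  - by exists M0 => // M /= M0M; exists M.
  - by apply: open_nbhs_nbhs; split=> //; exact: open_window.
  by exists M; split.
have sz M : size (s M) = (M + (size w + M))%N.
  by rewrite !size_cat; have [-> ->] := Hf M.
exists x; split; last first.
  exists 0; have [M [_ <-]] := agree 0 (size w) 0%N.
  have [l r _] := Hf M.
  rewrite (window_nth _ (add0r M%:Z)) ?sz; last by lia.
  by rewrite /s -{1}l drop_size_cat// take_size_cat.
move=> i u Fu; have [M [leM <-]] := agree i (size u) (`|i|%N + size u)%N.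
have [p ip] : exists p : nat, i + M%:Z = p%:Z.
  by exists `|(i + M%:Z)%R|%N; lia.
rewrite (window_nth _ ip) ?sz; last by lia.
have [_ _ /admP/(_ u Fu)] := Hf M; apply: contra => /eqP e.
rewrite -[X in infix X _]e.
exact: infix_trans (infix_take _ _) (infix_drop _ _).
Qed.

Lemma extendable_uniform n : (0 < n)%N -> exists M, forall w, size w = n ->
  extendable M w -> language F w.
Proof.
move=> n0.
have /choice[f Hf] : forall t : n.-tuple A, exists M,
    extendable M t -> language F t.
  move=> t; apply: contrapT => /forallNP H; apply: (H 0%N) => _.
  apply: extendable_language; first by rewrite -size_eq0 size_tuple; lia.
  by move=> M; apply: contrapT => h; apply: (H M).
exists (\max_t f t)%N => w /eqP sw ew; apply: (Hf (Tuple sw)).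
exact: extendable_le (leq_bigmax _) ew.
Qed.

End Windows.

Section TopEntropy.
Variables (R : realType) (A : pointedFinType) (F : set (seq A)).
Variables (C lam : R).
Hypothesis lam_gt0 : 0 < lam.
Hypothesis lower : forall n, lam ^+ n <= nadm R F n.
Hypothesis upper : forall n, nadm R F n <= C * lam ^+ n.

Lemma nwords_wsum (W : set (seq A)) n :
  (nwords W n)%:R = wsum n (fun w => (`[< W w >])%:R) :> R.
Proof.
rewrite /nwords /wsum cardsE -sum1_card natr_sum big_mkcond /=.
by apply: eq_bigr => t _; rewrite unfold_in; case: asboolP.
Qed.

Lemma language_le_nadm n : (nwords (language F) n)%:R <= nadm R F n.
Proof.
rewrite nwords_wsum; apply: le_wsum => w _; rewrite ler_nat.
by case: asboolP => // /language_adm ->.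
Qed.

Let nextendable M n : R := wsum n (fun w => (extendable F M w)%:R).

Lemma extendable_submul_iter M n k : nextendable M (k * n) <= nextendable M n ^+ k.
Proof.
elim: k => [|k IH].
  by rewrite expr0 mul0n /nextendable wsum0 lern1 leq_b1.
rewrite mulSn exprS; apply: le_trans (_ : nextendable M n * nextendable M (k * n) <= _).
  rewrite /nextendable wsum_cat -wsumZr; apply: le_wsum => v _.
  rewrite -wsumZ; apply: le_wsum => w _; rewrite -natrM ler_nat mulnb.
  case: (boolP (extendable F M (v ++ w))) => // e.
  by rewrite (extendable_catl e) (extendable_catr e).
by apply: ler_wpM2l IH; exact: wsum_ge0.
Qed.

Lemma nadm_le_extendable M n :
  nadm R F (M + (n + M)) <= (#|A|%:R ^+ M) ^+ 2 * nextendable M n.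
Proof.
have cst (b : R) : wsum M (fun _ : seq A => b) = #|A|%:R ^+ M * b.
  by rewrite wsum_const mulrC.
rewrite expr2 -mulrA -cst /nadm wsum_cat; apply: le_wsum => l sl.
rewrite wsum_cat /nextendable -wsumZ; apply: le_wsum => w _.
rewrite -cst; apply: le_wsum => r sr; rewrite ler_nat.
case: (boolP (adm F _)) => // a; rewrite lt0b.
by apply/asboolP; exists l, r.
Qed.

Lemma language_ge n : (0 < n)%N ->
  0 < (nwords (language F) n)%:R :> R /\
  n%:R * ln lam <= ln ((nwords (language F) n)%:R : R).
Proof.
move=> n0; have [M HM] := extendable_uniform F n0.
set N : R := _%:R.
have ext k : lam ^+ (M + (k * n + M)) <= (#|A|%:R ^+ M) ^+ 2 * N ^+ k.
  apply: le_trans (lower _) _; apply: le_trans (nadm_le_extendable _ _) _.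
  rewrite ler_wpM2l ?exprn_ge0//; apply: le_trans (extendable_submul_iter _ _ _) _.
  apply: lerXn2r; rewrite ?nnegrE ?wsum_ge0// /N nwords_wsum.
  apply: le_wsum => w sw; rewrite ler_nat.
  by case: (boolP (extendable F M w)) => // /(HM w sw) /asboolP ->.
move: ((#|A|%:R ^+ M) ^+ 2) ext => K ext.
have K0 : 0 < K.
  have := ext 0%N; rewrite expr0 mulr1; apply: lt_le_trans.
  by rewrite exprn_gt0.
have N0 : 0 < N.
  rewrite lt_neqAle ler0n andbT; apply/negP => /eqP e.
  have := ext 1%N; rewrite -e expr1 mulr0 leNgt exprn_gt0//.
split=> //; rewrite -subr_le0.
apply: (@natmul_bounded_le0 _ _ (ln K - (M + M)%:R * ln lam)) => k.
have := ext k; rewrite -ler_ln ?posrE ?mulr_gt0 ?exprn_gt0//.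
rewrite lnM ?posrE ?exprn_gt0// !ln_exprn// !natrD natrM; lra.
Qed.

Lemma top_entropyE : top_entropy R F = ln lam.
Proof.
apply/cvg_lim => //; apply/cvgrPdist_le => e e0.
exists (Num.bound (`|ln C| / e)).+1 => // n /= Nn.
have n0 : (0 < n)%N by apply: leq_trans Nn.
have n0' : 0 < n%:R :> R by rewrite ltr0n.
have [L0 low] := language_ge n0; set L : R := _%:R in L0 low *.
have C0 : 0 < C.
  by have := le_trans (lower 0) (upper 0); rewrite !expr0 mulr1; apply: lt_le_trans.
have up : ln L <= `|ln C| + n%:R * ln lam.
  have : ln L <= ln (C * lam ^+ n).
    rewrite ler_ln ?posrE ?mulr_gt0 ?exprn_gt0//.
    exact: le_trans (language_le_nadm n) (upper n).
  rewrite lnM ?posrE ?exprn_gt0// ln_exprn//.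
  have := ler_norm (ln C); lra.
have Ce : `|ln C| <= n%:R * e.
  rewrite -ler_pdivrMr//; apply: ltW; apply: lt_le_trans (archi_boundP _) _.
    by rewrite divr_ge0// ltW.
  by rewrite ler_nat ltnW.
rewrite -(ler_pM2l n0') -{1}(ger0_norm (ltW n0')) -normrM mulrBr mulVKf ?gt_eqF//.
by rewrite ler_norml; apply/andP; split; lra.
Qed.

End TopEntropy.

(** * From invariant measures to word distributions *)

Section MeasureWords.
Variables (R : realType) (A : pointedFinType) (F : set (seq A)).
Variable mu : probability (borel_fullshift A) R.
Implicit Types (u v w : seq A) (x : fullshift A) (n : nat).

Lemma measurable_open (U : set (fullshift A)) :
  open U -> measurable (U : set (borel_fullshift A)).
Proof. exact: sub_sigma_algebra. Qed.

Lemma measurable_subshift : measurable (subshift F : set (borel_fullshift A)).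
Proof.
rewrite -[subshift F]setCK; apply: measurableC; apply: measurable_open.
rewrite (_ : ~` _ = \bigcup_(i in [set: int]) \bigcup_(u in F)
    [set x | window x i (size u) = u]).
  by apply: bigcup_open => i _; apply: bigcup_open => u _; exact: open_window.
apply/seteqP; split=> x /=; last first.
  by case=> i _ [u Fu /= e] /(_ i u Fu); rewrite e eqxx.
move=> nx; apply: contrapT => H; apply: nx => i u Fu; apply/eqP => e.
by apply: H; exists i => //; exists u.
Qed.

Lemma cylinderE w :
  cylinder F w = subshift F `&` [set x | window x 1 (size w) = w].
Proof. by apply/seteqP; split. Qed.

Lemma measurable_cylinder w :
  measurable (cylinder F w : set (borel_fullshift A)).
Proof.
rewrite cylinderE; apply: measurableI; first exact: measurable_subshift.
by apply: measurable_open; exact: open_window.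
Qed.

Lemma cylinder_inj v w x : size v = size w ->
  cylinder F v x -> cylinder F w x -> v = w.
Proof. by move=> e [_ <-] [_ <-]; rewrite e. Qed.

Lemma measure_finite_partition (T : finType) (p : pred T)
    (B : T -> set (borel_fullshift A)) (D : set (borel_fullshift A)) :
  (forall t, measurable (B t)) ->
  (forall s t x, B s x -> B t x -> s = t) ->
  (forall x, D x <-> exists t, p t /\ B t x) ->
  mu D = (\sum_(t | p t) fine (mu (B t)))%:E.
Proof.
move=> mB dB DB.
have H (r : seq T) : uniq r ->
    mu (\big[setU/set0]_(t <- r) B t) = (\sum_(t <- r) fine (mu (B t)))%:E.
  elim: r => [|t r IH]; first by rewrite !big_nil measure0.
  rewrite cons_uniq => /andP[tr ur]; rewrite !big_cons measureU//.
  - by rewrite EFinD fineK ?fin_num_measure//; congr (_ + _)%E; exact: IH.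
  - exact: bigsetU_measurable.
  - apply/seteqP; split=> x //= [Bt]; rewrite -bigcup_seq => -[s /= sr Bs].
    by move: tr; rewrite (dB _ _ _ Bt Bs) sr.
rewrite -big_filter -H ?filter_uniq ?index_enum_uniq//; congr (mu _).
rewrite -bigcup_seq; apply/seteqP; split=> x /=.
  case/DB => t [pt Bt]; exists t => //=.
  by rewrite mem_filter pt mem_index_enum.
by case=> t /=; rewrite mem_filter => /andP[pt _] Bt; apply/DB; exists t.
Qed.

Definition cylinder_mass w : R := fine (mu (cylinder F w)).

Lemma cylinder_massE w : mu (cylinder F w) = (cylinder_mass w)%:E.
Proof. by rewrite fineK// fin_num_measure//; exact: measurable_cylinder. Qed.

Lemma cylinder_mass_language w : w != [::] -> cylinder_mass w != 0 ->
  language F w.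
Proof.
move=> w0 mw; split=> //; apply: contrapT => H; case/eqP: mw.
rewrite /cylinder_mass (_ : cylinder F w = set0) ?measure0//.
by apply/seteqP; split=> x // [xX e]; apply: H; exists x; split=> //; exists 1.
Qed.

Hypothesis inv : shift_invariant mu.
Hypothesis supp : mu (subshift F) = 1%E.

Lemma cylinder_mass_distribution : word_distribution F cylinder_mass.
Proof.
split.
- by move=> w; rewrite fine_ge0.
- rewrite /cylinder_mass (_ : cylinder F [::] = subshift F) ?supp//.
  by apply/seteqP; split=> x //; case.
- move=> w; rewrite /cylinder_mass [in RHS](@measure_finite_partition A xpredT
    (fun a => cylinder F (w ++ [:: a])))//.
  + by move=> a; exact: measurable_cylinder.
  + move=> a b x Ba Bb; have := cylinder_inj _ Ba Bb.
    by rewrite !size_cat => /(_ erefl)/eqP; rewrite eqseq_cat// eqxx => /eqP[].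
  + move=> x; split.
      case=> xX e; exists (x (1 + (size w)%:Z)); split=> //; split=> //.
      by rewrite size_cat window_cat e windowS.
    case=> a [_ [xX]]; rewrite size_cat window_cat => /eqP.
    by rewrite eqseq_cat ?size_window// => /andP[/eqP e _]; split.
- move=> w; rewrite /cylinder_mass -[in RHS](inv (measurable_cylinder w)).
  rewrite [in RHS](@measure_finite_partition A xpredT
    (fun a => cylinder F (a :: w)))//.
  + by move=> a; exact: measurable_cylinder.
  + by move=> a b x Ba Bb; have [] := @cylinder_inj (a :: w) (b :: w) x erefl Ba Bb.
  + move=> x; split.
      case=> /subshift_shift xX; rewrite window_shift => e.
      by exists (x 1); split=> //; split=> //=; rewrite windowS e.
    case=> a [_ [xX]]; rewrite /= windowS => -[_ e].
    by split; [exact/subshift_shift|rewrite window_shift].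
- move=> w; apply: contraNeq => mw; case: w mw => [|a w] mw; last first.
    by apply: language_adm; exact: cylinder_mass_language.
  have : cylinder F [::] !=set0.
    apply/set0P; apply: contraNneq mw => e.
    by rewrite /cylinder_mass e measure0.
  by case=> x [xX _]; exact: (subshift_adm 0 0 xX).
Qed.

Lemma measure_entropyE : exists l, [/\ measure_entropy F mu = l &
  forall n, n%:R * l <= word_entropy cylinder_mass n].
Proof.
have PF := cylinder_mass_distribution.
have [l [cvl lowl]] := fekete (word_entropy_subadd PF) (word_entropy_ge0 PF).
exists l; split=> //; apply/cvg_lim => //.
apply: cvg_trans cvl; apply: near_eq_cvg; apply: nearW => n.
by rewrite /word_entropy mulrN mulNr.
Qed.

Lemma good'E w : good' F w <->
  [/\ language F w, ~~ heavy_prefix F w & ~~ heavy_suffix F w].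
Proof.
by split=> -[lw /heavy_endPn hp /heavy_endPn hs]; split=> //; apply/heavy_endPn.
Qed.

Lemma good'_union_ge n : (0 < n)%N ->
  ((1 - wsum n (fun w => (heavy_prefix F w)%:R * cylinder_mass w)
      - wsum n (fun w => (heavy_suffix F w)%:R * cylinder_mass w))%:E
   <= mu (good'_union F n))%E.
Proof.
move=> n0; have PF := cylinder_mass_distribution.
rewrite (@measure_finite_partition (n.-tuple A) (fun t => `[< good' F t >])
  (fun t => cylinder F t)).
- rewrite lee_fin [leRHS]big_mkcond /= -[X in X - _ - _ <= _](wd_total PF n).
  apply: le_trans (_ : wsum n (fun w => cylinder_mass w +
     -1 * ((heavy_prefix F w)%:R * cylinder_mass w) +
     -1 * ((heavy_suffix F w)%:R * cylinder_mass w)) <= _).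
    by rewrite !wsumD !wsumZ !mulN1r.
  apply: ler_sum => t _; rewrite -/(cylinder_mass t).
  have m0 : 0 <= cylinder_mass t by exact: (wd_ge0 PF).
  case: asboolP => [_|ng].
    by rewrite !mulN1r -addrA gerDl; rewrite -opprD oppr_le0 addr_ge0// mulr_ge0.
  have [mt|mt] := eqVneq (cylinder_mass t) 0; first by rewrite mt !mulr0 !addr0.
  have t0 : (t : seq A) != [::] by rewrite -size_eq0 size_tuple -lt0n.
  have lt := cylinder_mass_language t0 mt.
  have [hp|hp] := boolP (heavy_prefix F t).
    by rewrite mul1r mulN1r subrr add0r mulN1r oppr_le0 mulr_ge0.
  have [hs|hs] := boolP (heavy_suffix F t).
    by rewrite mul1r mul0r mulr0 addr0 mulN1r subrr.
  by case: ng; apply/good'E.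
- by move=> t; exact: measurable_cylinder.
- move=> s t x Bs Bt; apply: val_inj; apply: cylinder_inj Bs Bt.
  by rewrite !size_tuple.
- move=> x; split.
    case=> w [gw /eqP sw] xw; exists (Tuple sw); split=> //.
    exact/asboolP.
  case=> t [/asboolP gt xt]; exists (tval t) => //; split=> //.
  by rewrite size_tuple.
Qed.

End MeasureWords.

(** * The summability hypothesis *)

Section Weight.
Variables (R : realType) (A : pointedFinType) (F : set (seq A)).
Hypothesis F_sum : (\sum_(1 <= n <oo)
                ((n ^ 2)%:R * (nwords F n)%:R *
                 ((3 / #|A|%:R : R) `^ (n%:R / 4)))%:E < (36^-1)%:E)%E.

Let term n : R := (n ^ 2)%:R * (nwords F n)%:R * (3 / #|A|%:R) `^ (n%:R / 4).

Lemma card_alphabet_gt0 : (0 < #|A|)%N.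
Proof. by apply/card_gt0P; exists point. Qed.

Lemma term_ge0 n : 0 <= term n.
Proof. by rewrite mulr_ge0// powR_ge0. Qed.

Lemma term_sum N : \sum_(1 <= n < N) term n <= 36^-1.
Proof.
rewrite -lee_fin -sumEFin; apply: le_trans (ltW F_sum).
by apply: nneseries_lim_ge => n _ _; rewrite lee_fin term_ge0.
Qed.

Lemma term_lt1 n : (0 < n)%N -> term n < 1.
Proof.
move=> n0; have := term_sum n.+1; rewrite big_nat_recr//=.
have : 0 <= \sum_(1 <= i < n) term i by rewrite sumr_ge0// => i _; exact: term_ge0.
by lra.
Qed.

(** If there is a forbidden word of length [n], then [3 / #|A|] is at most one, as
    otherwise the [n]-th term of the series would be at least one.  Hence raising
    it to the power [quarter n] instead of [n / 4] makes it smaller. *)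
Lemma weight_of_sum N : \sum_(1 <= n < N)
  n%:R * (nwords F n)%:R * (#|A|%:R / 3) ^- quarter n <= 36^-1 :> R.
Proof.
apply: le_trans (term_sum N); rewrite big_nat_cond [leRHS]big_nat_cond.
apply: ler_sum => n /andP[/andP[n0 _] _].
have [->|Fn] := posnP (nwords F n); first by rewrite mulr0 mul0r term_ge0.
set r : R := 3 / #|A|%:R.
have K0 : 0 < #|A|%:R :> R by rewrite ltr0n card_alphabet_gt0.
have r0 : 0 < r by rewrite divr_gt0.
have r1 : r <= 1.
  rewrite leNgt; apply/negP => r1; have := term_lt1 n0; rewrite ltNge => /negP; apply.
  rewrite /term -/r -natrM; apply: mulr_ege1.
    by rewrite ler1n muln_gt0 expn_gt0 n0.
  by rewrite -[leLHS](powRr0 r); apply: ler_powR; rewrite ?divr_ge0// ltW.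
rewrite /term -/r ler_pM//.
  by rewrite ler_wpM2r// ler_nat -mulnn leq_pmull.
rewrite -exprVn invf_div -/r -powR_mulrn ?(ltW r0)//.
apply: ger_powR; first by rewrite r0.
rewrite ler_pdivrMr// -natrM ler_nat /quarter; lia.
Qed.

End Weight.

(** * The theorem *)

Unset Implicit Arguments.

Theorem theorem7p3 (R : realType) (A : pointedFinType) (F : set (seq A))
    (F_nonempty_words : ~ F [::])
    (F_sum : (\sum_(1 <= n <oo)
                ((n ^ 2)%:R * (nwords F n)%:R *
                 ((3 / #|A|%:R : R) `^ (n%:R / 4)))%:E < (36^-1)%:E)%E)
    (mu : probability (borel_fullshift A) R) (mu_MME : is_MME F mu) :
  (exists (eps : R) (S : set nat),
     [/\ 0 < eps, syndetic S &
         forall n : nat, S n -> (eps%:E < mu (good'_union F n))%E]) /\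
  (exists D D' : R,
     [/\ 0 < D, 0 < D' &
         forall w : seq A, good' F w ->
           ((D * expR (- ((size w)%:R * top_entropy R F)))%:E
              <= mu (cylinder F w))%E /\
           (mu (cylinder F w)
              <= (D' * expR (- ((size w)%:R * top_entropy R F)))%:E)%E]).
Proof.
have [inv supp ent] := mu_MME.
have weight := weight_of_sum F_sum; set c : R := #|A|%:R / 3 in weight.
have c_gt0 : 0 < c by rewrite divr_gt0// ltr0n card_alphabet_gt0.
have cardA : #|A|%:R = 3 * c by rewrite mulrC divfK.
have [h [c_le lower upper]] := nadm_rate F_nonempty_words c_gt0 cardA weight.
have lam_gt0 : 0 < expR h by exact: expR_gt0.
have topE := top_entropyE lam_gt0 lower upper; rewrite expRK in topE.
set C : R := (36 / 35) ^+ 2 in upper.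
have C_gt0 : 0 < C by rewrite exprn_gt0// divr_gt0.
have C_le : C <= 3 / 2 by rewrite /C; lra.
have PF := cylinder_mass_distribution inv supp.
have [l [entl entropy]] := measure_entropyE inv supp.
have {entl entropy}entropy n : n%:R * ln (expR h) <= word_entropy (cylinder_mass F mu) n.
  by rewrite expRK -topE -ent entl.
split.
  exists (1 / 2), [set n | (0 < n)%N]; split; first lra.
    by exists 2%N => k; exists k.+1; split=> //; rewrite leqnSn addn2 ltnS leqnn.
  move=> n /= n0; apply: lt_le_trans (good'_union_ge inv supp n0); rewrite lte_fin.
  have := wd_heavy_prefix F_nonempty_words c_gt0 weight PF C_gt0 C_le c_le upper entropy n.
  have := wd_heavy_suffix F_nonempty_words c_gt0 weight PF C_gt0 C_le c_le upper entropy n.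
  by lra.
exists (7 * (4 * C) ^+ 3)^-1, (2 * C); split.
- by rewrite invr_gt0 !mulr_gt0// exprn_gt0// mulr_gt0.
- by rewrite mulr_gt0.
move=> w /good'E[lw hp hs].
have w0 : (0 < size w)%N by case: lw; rewrite -size_eq0 lt0n.
rewrite topE expRN expRM_natl cylinder_massE !lee_fin; split.
  exact: (lower_gibbs F_nonempty_words c_gt0 weight PF C_gt0 C_le c_le upper
    entropy (language_adm lw)).
exact: (upper_gibbs PF C_gt0 lam_gt0 upper entropy).
Qed.
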